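(* For $w\in\mathbb{F}$, the bounded linear operator \[ l_1\ni z:=(z_k)_{k\in\mathbb{N}}\mapsto\hat{A}_wz:=w\left(\frac{k+2}{k+1}z_{k+1}-\frac{1}{k(k+1)}\sum_{j=0}^{k}z_j\right)_{k\in\mathbb{N}}\in l_1 \] with $z_0:=-\sum_{k=1}^\infty z_k$, on the space $l_1$ is 1. non-hypercyclic (i.e., not hypercyclic) for $|w|<1$, 2. hypercyclic but not chaotic for $|w|=1$, and 3. chaotic as well as its every power \[ l_1\ni z:=(z_k)_{k\in\mathbb{N}}\mapsto\hat{A}_w^{\,n}z=w^n\left(\frac{k+1+n}{k+1}z_{k+n}-\frac{n}{k(k+1)}\sum_{j=0}^{k-1+n}z_j\right)_{k\in\mathbb{N}}\in l_1,\quad n\in\mathbb{N}, \] with $z_0:=-\sum_{k=1}^\infty z_k$, for $|w|>1$. Provided the space $l_1$ is complex (i.e., $\mathbb{F}=\mathbb{C}$), \[ \sigma(\hat{A}_w)=\{\lambda\in\mathbb{C}\mid|\lambda|\le|w|\} \] with \[ \sigma_p(\hat{A}_w)=\{\lambda\in\mathbb{C}\mid|\lambda|<|w|\}\cup\{w\}\quad\text{and}\quad\sigma_c(\hat{A}_w)=\{\lambda\in\mathbb{C}\mid|\lambda|=|w|\}\setminus\{w\}. \]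
   Context: $\mathbb{F}:=\mathbb{R}$ or $\mathbb{F}:=\mathbb{C}$; $\mathbb{N}=\{1,2,3,\dots\}$, $\mathbb{Z}_+=\{0,1,2,\dots\}$; $l_1$ is the Banach space over $\mathbb{F}$ of absolutely summable sequences $(z_k)_{k\in\mathbb{N}}\in\mathbb{F}^{\mathbb{N}}$ with the norm $\|z\|_1=\sum_{k=1}^\infty|z_k|$. For a (bounded or unbounded) linear operator $A$ in a (real or complex) Banach space $E$ with domain $D(A)$, let $A^0:=I$ and $C^\infty(A):=\bigcap_{n=0}^\infty D(A^n)$. A nonzero vector $x\in C^\infty(A)$ is hypercyclic for $A$ if its orbit $\{A^nx\}_{n\in\mathbb{Z}_+}$ is dense in $E$; $A$ is hypercyclic if it has a hypercyclic vector. A vector $x\in D(A^N)$ with $A^Nx=x$ for some $N\in\mathbb{N}$ is a periodic point of $A$. $A$ is chaotic if it is hypercyclic and its set of periodic points is dense in $E$. For a closed linear operator $A$ in a complex Banach space $E$, the spectrum $\sigma(A)$ is the disjoint union of the point spectrum $\sigma_p(A)=\{\lambda\in\mathbb{C}\mid A-\lambda I\text{ is not injective}\}$, the continuous spectrum $\sigma_c(A)=\{\lambda\in\mathbb{C}\mid A-\lambda I\text{ is injective, not surjective, and has dense range}\}$, and the residual spectrum $\sigma_r(A)=\{\lambda\in\mathbb{C}\mid A-\lambda I\text{ is injective and its range is not dense}\}$. *)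

(* Defs.v *)
From HB Require Import structures.
From mathcomp Require Import all_boot all_order all_algebra.
From mathcomp Require Import complex ring zify.
From mathcomp Require Import boolp classical_sets functions reals topology.
From mathcomp Require Import normedtype sequences.

Set Implicit Arguments.
Unset Strict Implicit.
Unset Printing Implicit Defensive.

Import Order.TTheory GRing.Theory Num.Theory.
Import Normc.
Import numFieldNormedType.Exports.

Local Open Scope classical_set_scope.
Local Open Scope ring_scope.

(* The operators occurring here are defined on the whole space, so that
   D(A^n) = E for all n and C^oo(A) = E. *)
Section operators.
Context (K : numFieldType) (E : normedModType K).
Implicit Types (A : E -> E) (x : E) (lambda : K).

Definition bounded_operator A :=
  linear A /\ exists M : K, forall x, `|A x| <= M * `|x|.

Definition hypercyclic_vector A x :=
  x != 0 /\ dense [set iter n A x | n in [set: nat]].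

Definition hypercyclic A := exists x, hypercyclic_vector A x.

Definition periodic_point A x := exists2 N, (0 < N)%N & iter N A x = x.

Definition chaotic A := hypercyclic A /\ dense [set x | periodic_point A x].

Definition shifted A lambda x := A x - lambda *: x.

(* For a bounded operator on a Banach space the complement of the resolvent set
   is the set of lambda for which A - lambda I is not bijective, i.e., the union
   of the point, continuous and residual spectra. *)
Definition resolvent_set A : set K := [set lambda |
  exists2 B : E -> E, bounded_operator B &
    cancel (shifted A lambda) B /\ cancel B (shifted A lambda)].

Definition spectrum A : set K := ~` resolvent_set A.

Definition point_spectrum A : set K :=
  [set lambda | ~ injective (shifted A lambda)].

Definition continuous_spectrum A : set K := [set lambda |
  [/\ injective (shifted A lambda),
      range (shifted A lambda) <> setT &
      dense (range (shifted A lambda))]].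

End operators.

(* The two possible base fields; absv is the modulus as an element of R, whereas
   the norm of the numFieldType R[i] takes its values in R[i]. *)
Variant scalar_kind := real_scalars | complex_scalars.

Section scalars.
Variable R : realType.

Definition scalars (s : scalar_kind) : numFieldType :=
  match s with
  | real_scalars => R : numFieldType
  | complex_scalars => R[i] : numFieldType
  end.

Definition absv (s : scalar_kind) : scalars s -> R :=
  match s with
  | real_scalars => fun x : R => `|x|
  | complex_scalars => fun x : R[i] => normc x
  end.

Definition of_real (s : scalar_kind) : R -> scalars s :=
  match s with
  | real_scalars => fun x : R => x
  | complex_scalars => fun x : R => x%:C%C
  end.

Variable s : scalar_kind.
Local Notation F := (scalars s).

Lemma normr_absv (x : F) : `|x| = of_real s (absv x).
Proof. by case: s x. Qed.

Lemma absv0 : absv (0 : F) = 0.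
Proof. case: s => /=; [exact: normr0 | exact: normc0]. Qed.

Lemma absv0_eq0 (x : F) : absv x = 0 -> x = 0.
Proof. by case: s x => x /=; [move/normr0_eq0 | move/eq0_normc]. Qed.

Lemma absvM (x y : F) : absv (x * y) = absv x * absv y.
Proof. by case: s x y => x y /=; [exact: normrM | exact: normcM]. Qed.

Lemma absvN (x : F) : absv (- x) = absv x.
Proof. by case: s x => x /=; [exact: normrN | exact: normcN]. Qed.

Lemma absvD (x y : F) : absv (x + y) <= absv x + absv y.
Proof. by case: s x y => x y /=; [exact: ler_normD | exact: le_normcD]. Qed.

Lemma absv_ge0 (x : F) : 0 <= absv x.
Proof. by case: s x => [x|[a b]] //=; exact: sqrtr_ge0. Qed.

Lemma absv_nat n : absv (n%:R : F) = n%:R.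
Proof.
case: s => /=; first exact: normr_nat.
by rewrite -(rmorph_nat (real_complex R)) /= expr0n addr0 sqrtr_sqr normr_nat.
Qed.

Lemma absvV (x : F) : absv x^-1 = (absv x)^-1.
Proof. by case: s x => x /=; [exact: normfV | exact: normcV]. Qed.

Lemma of_realD x y : of_real s (x + y) = of_real s x + of_real s y.
Proof. by case: s => //=; rewrite rmorphD. Qed.

Lemma of_realM x y : of_real s (x * y) = of_real s x * of_real s y.
Proof. by case: s => //=; rewrite rmorphM. Qed.

Lemma ler_of_real x y : (of_real s x <= of_real s y) = (x <= y).
Proof. by case: s => //=; rewrite lecR. Qed.

Lemma of_real_eq0 x : of_real s x = 0 -> x = 0.
Proof. by case: s => //= -[]. Qed.

End scalars.

Section l1.
Variables (R : realType) (s : scalar_kind).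
Local Notation F := (scalars R s).
Implicit Types z : nat -> F.

Definition abs_summable z := cvgn (series (fun k => absv (z k))).

Definition abs_sum z : R := limn (series (fun k => absv (z k))).

Lemma abs_series_ndecr z :
  {homo series (fun k => absv (z k)) : m n / (m <= n)%N >-> m <= n}.
Proof.
apply/nondecreasing_seqP => n.
by rewrite !seriesEnat/= big_nat_recr//= lerDl absv_ge0.
Qed.

Lemma le_abs_sum z n : abs_summable z ->
  series (fun k => absv (z k)) n <= abs_sum z.
Proof.
by move=> zs; apply: nondecreasing_cvgn_le => //; exact: abs_series_ndecr.
Qed.

Lemma abs_summable_bounded z (M : R) :
  (forall n, series (fun k => absv (z k)) n <= M) ->
  abs_summable z /\ abs_sum z <= M.
Proof.
move=> zM.
have zs : abs_summable z.
  apply: nondecreasing_is_cvgn; first exact: abs_series_ndecr.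
  by exists M => _ [n _ <-]; exact: zM.
by split=> //; apply: limr_le => //; exact: nearW.
Qed.

Lemma abs_summable0 : abs_summable (fun=> 0).
Proof.
apply: (proj1 (@abs_summable_bounded _ 0 _)) => n.
by rewrite seriesEnat/= big1// => i _; exact: absv0.
Qed.

Lemma abs_summableZ (a : F) z : abs_summable z ->
  abs_summable (fun k => a * z k) /\
  abs_sum (fun k => a * z k) = absv a * abs_sum z.
Proof.
move=> zs.
have E : series (fun k => absv (a * z k)) =
         (fun n => absv a * series (fun k => absv (z k)) n).
  apply/funext => n; rewrite !seriesEnat/= mulr_sumr.
  by apply: eq_bigr => i _; exact: absvM.
rewrite /abs_summable /abs_sum E; split.
  exact: is_cvgMr.
by apply/cvg_lim => //; exact: cvgMr.
Qed.

Lemma abs_summableD z t : abs_summable z -> abs_summable t ->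
  abs_summable (fun k => z k + t k) /\
  abs_sum (fun k => z k + t k) <= abs_sum z + abs_sum t.
Proof.
move=> zs ts; apply: abs_summable_bounded => n.
apply: (@le_trans _ _ (series (fun k => absv (z k)) n +
                       series (fun k => absv (t k)) n)).
  rewrite !seriesEnat/= -big_split/=; apply: ler_sum => i _; exact: absvD.
by apply: lerD; exact: le_abs_sum.
Qed.

Definition l1_pred : {pred nat -> F^o} := fun z => `[< abs_summable z >].

Lemma l1_submod_closed : submod_closed l1_pred.
Proof.
split=> [|a z t]; first exact/asboolP/abs_summable0.
move=> /asboolP zs /asboolP ts; apply/asboolP.
exact: (abs_summableD (abs_summableZ a zs).1 ts).1.
Qed.
HB.instance Definition _ :=
  GRing.isSubmodClosed.Build F (nat -> F^o) l1_pred l1_submod_closed.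

(* The i-th entry of an element of l1 (i = 0, 1, ...) is the coordinate of
   index i + 1 of the sequence. F^o only selects F as a module over itself. *)
Record l1 := L1 { l1_seq :> nat -> F^o; _ : l1_seq \in l1_pred }.
HB.instance Definition _ := [isSub for l1_seq].
HB.instance Definition _ := [Choice of l1 by <:].
HB.instance Definition _ := [SubChoice_isSubLmodule of l1 by <:].

Lemma l1_summable (z : l1) : abs_summable z.
Proof. by case: z => z /= /asboolP. Qed.
Arguments l1_summable : clear implicits.

Definition l1_norm (z : l1) : F := of_real s (abs_sum z).

Lemma l1_normD (z t : l1) : l1_norm (z + t) <= l1_norm z + l1_norm t.
Proof.
rewrite /l1_norm -of_realD ler_of_real.
exact: (abs_summableD (l1_summable z) (l1_summable t)).2.
Qed.

Lemma l1_normZ (a : F) (z : l1) : l1_norm (a *: z) = `|a| * l1_norm z.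
Proof.
rewrite /l1_norm normr_absv -of_realM; congr of_real.
exact: (abs_summableZ a (l1_summable z)).2.
Qed.

Lemma l1_norm_eq0 (z : l1) : l1_norm z = 0 -> z = 0.
Proof.
move/of_real_eq0 => z0; apply/val_inj/funext => k /=; apply/absv0_eq0/le_anti.
rewrite absv_ge0 andbT -z0.
apply: le_trans (le_abs_sum k.+1 (l1_summable z)).
by rewrite seriesEnat/= big_nat_recr//= lerDr sumr_ge0// => i _; exact: absv_ge0.
Qed.

HB.instance Definition _ :=
  Lmodule_isNormed.Build F l1 l1_normD l1_normZ l1_norm_eq0.

End l1.

Section hatA.
Variables (R : realType) (s : scalar_kind).
Local Notation F := (scalars R s).

(* In the 1-based notation of the mathematics, l1_coord z k is z_k for k >= 1, and
   l1_coord z 0 is z_0 = - sum_(k >= 1) z_k. *)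
Definition l1_coord (z : l1 R s) (k : nat) : F :=
  if k is i.+1 then z i else - limn (series (z : nat -> F)).

Definition hatA_coord (w : F) (z : l1 R s) (k : nat) : F :=
  w * ((k + 2)%:R / (k + 1)%:R * l1_coord z k.+1
       - (k * (k + 1))%:R^-1 * \sum_(0 <= j < k.+1) l1_coord z j).

Lemma abs_summable_hatA (w : F) (z : l1 R s) :
  (fun i => hatA_coord w z i.+1) \in @l1_pred R s.
Proof.
apply/asboolP; set S := abs_sum z; set c := absv (l1_coord z 0).
have Sge n : series (fun k => absv (z k)) n <= S.
  apply: le_abs_sum; exact: l1_summable.
have c0 : 0 <= c by exact: absv_ge0.
have S0 : 0 <= S by have := Sge 0; rewrite seriesEnat/= big_geq.
have partial k : absv (\sum_(0 <= j < k.+1) l1_coord z j) <= c + S.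
  rewrite big_nat_recl//=; apply: le_trans (absvD _ _) _; rewrite lerD2l.
  apply: le_trans (Sge k); rewrite seriesEnat/=.
  elim: k => [|k IH]; first by rewrite !big_geq// absv0.
  by rewrite !big_nat_recr//=; apply: le_trans (absvD _ _) _; rewrite lerD2r.
have bnd i : absv (hatA_coord w z i.+1) <= absv w *
    (2 * absv (z i.+1) + (i.+1%:R^-1 - i.+2%:R^-1) * (c + S)).
  rewrite absvM; apply: ler_wpM2l; first exact: absv_ge0.
  apply: le_trans (absvD _ _) _; rewrite absvN !absvM !absvV !absv_nat.
  apply: lerD.
    apply: ler_wpM2r; first exact: absv_ge0.
    rewrite ler_pdivrMr ?ltr0n ?addn1// -natrM ler_nat.
    by lia.
  have -> : i.+1%:R^-1 - i.+2%:R^-1 = (i.+1 * (i.+1 + 1))%:R^-1 :> R.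
    rewrite addn1 natrM; field.
    by rewrite -[1 : R]/(1%:R) -!natrD !pnatr_eq0.
  by apply: ler_wpM2l; [rewrite invr_ge0 ler0n | exact: partial].
have tele n : \sum_(0 <= i < n) (i.+1%:R^-1 - i.+2%:R^-1) <= 1 :> R.
  suff -> : \sum_(0 <= i < n) (i.+1%:R^-1 - i.+2%:R^-1) = 1 - n.+1%:R^-1 :> R.
    by rewrite gerBl invr_ge0.
  elim: n => [|n IH]; first by rewrite big_geq// invr1 subrr.
  by rewrite big_nat_recr//= IH addrA subrK.
apply: (proj1 (@abs_summable_bounded _ _ _ (absv w * (2 * S + (c + S))) _)) => n.
rewrite seriesEnat/=; apply: le_trans (ler_sum _ _) _.
  by move=> i _; exact: bnd.
rewrite -mulr_sumr; apply: ler_wpM2l; first exact: absv_ge0.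
rewrite big_split/= -mulr_sumr -mulr_suml; apply: lerD.
  apply: ler_wpM2l => //; apply: le_trans (Sge n.+1).
  by rewrite seriesEnat/= big_nat_recl//= lerDr absv_ge0.
by rewrite -[leRHS]mul1r; apply: ler_wpM2r; rewrite ?addr_ge0.
Qed.

Definition hatA (w : F) (z : l1 R s) : l1 R s := L1 (abs_summable_hatA w z).

End hatA.

(* Main.v *)
(* With [s_k = z_0 + ... + z_k] (a null sequence of bounded variation) and
   [y_k = (k + 1) s_k], the operator [hatA w] becomes [w] times the backward
   shift [y_k -> w y_(k+1)], and finitely supported [y] are dense.  Since
   [|y_0| <= ||z||] and [|y_n| <= (n + 1) ||z||], orbits have bounded [y_0] when
   [|w| < 1].  The unit vector at position [n] in the coordinates [y] has norm
   at most [2 / (n + 1)], so for [|w| >= 1] a sparse sum of shifted finite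
   vectors is hypercyclic, and for [|w| > 1] periodic points are dense.  The
   divergence of the harmonic series excludes [y_k = mu^k] with [|mu| >= 1],
   [mu != 1], from [l1]; this leaves too few periodic points when [|w| = 1] and
   gives injectivity on the circle [|lambda| = |w|] away from [w].  Outside this
   circle the resolvent is a Neumann series, because [||A^n||] is at most
   [(2n + 1) |w|^n]; on it, the range contains all finitely supported [y] but
   misses a resonant right-hand side. *)
Require Import Defs.
From mathcomp Require Import all_boot all_order all_algebra.
From mathcomp Require Import complex ring lra zify.
From mathcomp Require Import boolp classical_sets functions reals topology.
From mathcomp Require Import normedtype sequences.
Import Order.TTheory GRing.Theory Num.Theory.
Import numFieldNormedType.Exports.
Local Open Scope classical_set_scope.
Local Open Scope ring_scope.

Set Implicit Arguments.
Unset Strict Implicit.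
Unset Printing Implicit Defensive.

(** * Moduli and limits of scalars over either base field *)

Section scalar_facts.
Variables (R : realType) (s : scalar_kind).
Local Notation F := (scalars R s).

Lemma ltr_of_real (x y : R) : (of_real s x < of_real s y) = (x < y).
Proof. by case: s => //=; rewrite ltcR. Qed.

Lemma ltr0_of_real (x : R) : (0 < of_real s x) = (0 < x).
Proof. by rewrite -ltr_of_real; case: s. Qed.

Lemma of_real_inj : injective (@of_real R s).
Proof. by case: s => // x y; exact: complexI. Qed.

Lemma of_real1 : of_real s (1 : R) = 1.
Proof. by case: s. Qed.

(** A complex number is positive only if its imaginary part vanishes, so every tolerance in [F]
    comes from one in [R]. *)
Lemma of_real_gt0 (e : F) : 0 < e -> exists2 r : R, 0 < r & e = of_real s r.
Proof.
case: s e => [e e0 | [a b]]; first by exists e.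
by rewrite ltcE /= => /andP[/eqP -> a0]; exists a.
Qed.

Lemma absv_sum (I : Type) (r : seq I) (P : pred I) (f : I -> F) :
  absv (\sum_(i <- r | P i) f i) <= \sum_(i <- r | P i) absv (f i).
Proof.
elim/big_ind2: _ => [|x a y b xa yb|//]; first by rewrite absv0.
by apply: le_trans (absvD _ _) _; exact: lerD.
Qed.

Lemma absv1 : absv (1 : F) = 1.
Proof. exact: (absv_nat R s 1). Qed.

Lemma absv_of_real (x : R) : absv (of_real s x) = `|x|.
Proof. by case: s => //=; rewrite expr0n addr0 sqrtr_sqr. Qed.

Lemma of_real_natV n : of_real s (n%:R^-1 : R) = n%:R^-1.
Proof. by case: s => //=; rewrite fmorphV rmorph_nat. Qed.

Lemma absvX (x : F) n : absv (x ^+ n) = absv x ^+ n.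
Proof.
by elim: n => [|n IH]; rewrite ?expr0 ?absv1 // !exprS absvM IH.
Qed.

Lemma lerB_absv (x y : F) : absv x - absv y <= absv (x - y).
Proof. by rewrite lerBlDr -{1}(subrK y x); exact: absvD. Qed.

Lemma absv_gt0 (x : F) : (0 < absv x) = (x != 0).
Proof.
rewrite lt_neqAle absv_ge0 andbT eq_sym; apply/idP/idP; apply: contra_neq.
  by move=> ->; rewrite absv0.
exact: absv0_eq0.
Qed.

Lemma absv_cvgP (u : nat -> F) (l : F) : u n @[n --> \oo] --> l <->
  forall e : R, 0 < e -> \forall n \near \oo, absv (l - u n) < e.
Proof.
split=> [/cvgrPdist_lt ul e e0 | ul].
  have := ul (of_real s e); rewrite ltr0_of_real => /(_ e0).
  by apply: filterS => n; rewrite normr_absv ltr_of_real.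
apply/cvgrPdist_lt => e /of_real_gt0[r r0 ->].
by apply: filterS (ul r r0) => n; rewrite normr_absv ltr_of_real.
Qed.

End scalar_facts.

(** * Convergence of absolutely summable scalar series *)

Lemma real_abs_summable_cvg (R : realType) (z : nat -> R) :
  cvgn (series (fun k => `|z k|)) -> cvgn (series z).
Proof. exact: normed_cvg. Qed.

Lemma real_dominated_cvg (R : realType) (z b : nat -> R) :
  (forall k, `|z k| <= b k) -> cvgn (series b) -> cvgn (series z).
Proof.
move=> zb bc; apply: real_abs_summable_cvg.
by apply: series_le_cvg bc => // k; exact: le_trans (zb k).
Qed.

Lemma normc_le_Re_Im (R : rcfType) (a b : R) :
  Normc.normc (Complex a b) <= `|a| + `|b|.
Proof.
rewrite /= -[leRHS]ger0_norm ?addr_ge0 // -[leRHS]sqrtr_sqr; apply: ler_wsqrtr.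
by rewrite sqrrD !real_normK ?num_real // -addrA lerD2l lerDr mulrn_wge0 // mulr_ge0.
Qed.

Lemma Re_le_normc (R : rcfType) (x : R[i]) : `|complex.Re x| <= Normc.normc x.
Proof. by case: x => a b /=; rewrite -sqrtr_sqr ler_wsqrtr // lerDl sqr_ge0. Qed.

Lemma Im_le_normc (R : rcfType) (x : R[i]) : `|complex.Im x| <= Normc.normc x.
Proof. by case: x => a b /=; rewrite -sqrtr_sqr ler_wsqrtr // lerDr sqr_ge0. Qed.

(** Over [R[i]] the real and imaginary parts are dominated by the modulus and converge separately.
    Hence the [limn] inside [l1_coord z 0] is a true limit. *)
Lemma abs_summable_cvg (R : realType) (s : scalar_kind) (z : nat -> scalars R s) :
  abs_summable z -> cvgn (series z).
Proof.
case: s z => z zs; first exact: (@real_abs_summable_cvg R z).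
have Rec := real_dominated_cvg (fun k => Re_le_normc (z k)) zs.
have Imc := real_dominated_cvg (fun k => Im_le_normc (z k)) zs.
pose l : scalars R complex_scalars :=
  Complex (limn (series (fun k => complex.Re (z k))))
          (limn (series (fun k => complex.Im (z k)))).
have sE n : l - series z n =
    Complex (limn (series (fun k => complex.Re (z k))) -
             series (fun k => complex.Re (z k)) n)
            (limn (series (fun k => complex.Im (z k))) -
             series (fun k => complex.Im (z k)) n).
  suff -> : series z n = Complex (series (fun k => complex.Re (z k)) n)
                                 (series (fun k => complex.Im (z k)) n) by [].
  rewrite !seriesEnat/=; elim: n => [|m IH]; first by rewrite !big_geq.
  by rewrite !big_nat_recr //= IH; case: (z m).
apply/cvg_ex; exists l; apply/absv_cvgP => e e0.
have e2 : 0 < e / 2 by rewrite divr_gt0.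
near=> n; rewrite sE; apply: le_lt_trans (normc_le_Re_Im _ _) _.
rewrite [ltRHS]splitr; apply: ltrD; near: n.
  exact: cvgr_dist_lt Rec _ e2.
exact: cvgr_dist_lt Imc _ e2.
Unshelve. all: by end_near. Qed.

Arguments l1_summable {R s} z.

(** * Tails of summable sequences and the shift coordinates *)

Section l1_tails.
Variables (R : realType) (s : scalar_kind).
Local Notation F := (scalars R s).
Local Notation l1 := (l1 R s).
Implicit Types z t : l1.

Lemma abs_sum_le z (M : R) :
  (forall n, \sum_(0 <= k < n) absv (z k) <= M) -> abs_sum z <= M.
Proof.
move=> zM; apply: (proj2 (abs_summable_bounded _)) => n.
by rewrite seriesEnat; exact: zM.
Qed.

Lemma sum_le_abs_sum z n : \sum_(0 <= k < n) absv (z k) <= abs_sum z.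
Proof. by have := le_abs_sum n (l1_summable z); rewrite seriesEnat. Qed.

Lemma abs_sum_ge0 z : 0 <= abs_sum z.
Proof. by have := sum_le_abs_sum z 0; rewrite big_geq. Qed.

Lemma abs_sumD z t : abs_sum (z + t) <= abs_sum z + abs_sum t.
Proof. exact: (abs_summableD (l1_summable z) (l1_summable t)).2. Qed.

Lemma abs_sumZ (a : F) z : abs_sum (a *: z) = absv a * abs_sum z.
Proof. exact: (abs_summableZ a (l1_summable z)).2. Qed.

Lemma abs_sumN z : abs_sum (- z) = abs_sum z.
Proof. by rewrite -scaleN1r abs_sumZ absvN absv1 mul1r. Qed.

Lemma abs_sum0 : abs_sum (0 : l1) = 0.
Proof. by rewrite -(scale0r (0 : l1)) abs_sumZ absv0 mul0r. Qed.

Lemma normr_l1 z : `|z| = of_real s (abs_sum z).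
Proof. by []. Qed.

(** As [l1_coord z 0] is minus the total sum, this is minus the remainder of the series from the
    entry [z k] on. *)
Definition l1_tail z k : F := \sum_(0 <= j < k.+1) l1_coord z j.

Lemma l1_tailE z k :
  l1_tail z k = series (z : nat -> F) k - limn (series (z : nat -> F)).
Proof. by rewrite /l1_tail big_nat_recl //= addrC seriesEnat. Qed.

Lemma l1_tailS z k : l1_tail z k.+1 = l1_tail z k + z k.
Proof. by rewrite /l1_tail big_nat_recr. Qed.

Lemma l1_tail_cvg z : l1_tail z n @[n --> \oo] --> (0 : F).
Proof.
rewrite (_ : l1_tail z =
  fun n => series (z : nat -> F) n - limn (series (z : nat -> F))).
  rewrite -[X in _ --> X](subrr (limn (series (z : nat -> F)))).
  by apply: cvgB; [exact/abs_summable_cvg/l1_summable | exact: cvg_cst].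
by apply/funext => k; exact: l1_tailE.
Qed.

(** Equal increments make the difference of the two sequences constant, and both tend to zero. Tails
    are thus identified by a recurrence, without computing a sum. *)
Lemma l1_tail_unique z (u : nat -> F) : u n @[n --> \oo] --> (0 : F) ->
  (forall k, u k.+1 = u k + z k) -> l1_tail z = u.
Proof.
move=> u0 uS; have d k : l1_tail z k - u k = l1_tail z 0 - u 0.
  by elim: k => // k <-; rewrite uS l1_tailS opprD addrACA subrr addr0.
have dc : (l1_tail z n - u n) @[n --> \oo] --> (0 : F).
  by rewrite -[X in _ --> X](subrr (0 : F)); apply: cvgB => //; exact: l1_tail_cvg.
have dc' : (l1_tail z n - u n) @[n --> \oo] --> l1_tail z 0 - u 0.
  by rewrite (funext d); exact: cvg_cst.
have d0 := cvg_unique _ dc' dc.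
by apply/funext => k; apply/eqP; rewrite -subr_eq0 d d0.
Qed.

Lemma l1_tail_linear (a : F) z t k :
  l1_tail (a *: z + t) k = a * l1_tail z k + l1_tail t k.
Proof.
rewrite (@l1_tail_unique _ (fun k => a * l1_tail z k + l1_tail t k)) // => [|i].
  rewrite -[X in _ --> X](addr0 0) -{1}(mulr0 a).
  apply: cvgD (l1_tail_cvg t); apply: cvgMl_tmp; exact: l1_tail_cvg.
rewrite !l1_tailS mulrDr; exact: addrACA.
Qed.

(** The tail at [k] exceeds a far tail by at most the moduli of the entries in between, and the far
    tail is as small as desired. *)
Lemma absv_l1_tail_le z k : absv (l1_tail z k) <= abs_sum z.
Proof.
apply/ler_addgt0Pr => e e0.
have [m _ me] := proj1 (absv_cvgP _ _) (l1_tail_cvg z) e e0.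
have telescope n : absv (l1_tail z k) <= absv (l1_tail z (n + k)) +
    (\sum_(0 <= j < n + k) absv (z j) - \sum_(0 <= j < k) absv (z j)).
  elim: n => [|n IH]; first by rewrite subrr addr0.
  rewrite addSn big_nat_recr //= l1_tailS; apply: le_trans IH _.
  have := lerB_absv (l1_tail z (n + k)) (- z (n + k)%N).
  by rewrite opprK absvN; lra.
apply: le_trans (telescope m) _.
have := me (m + k)%N; rewrite sub0r absvN /= leq_addr => /(_ isT).
have := sum_le_abs_sum z (m + k).
have : 0 <= \sum_(0 <= j < k) absv (z j) by apply: sumr_ge0 => *; exact: absv_ge0.
by lra.
Qed.

(** The increments of a null sequence of bounded variation form an element of [l1], whose norm is
    the total variation. *)
Lemma l1_of_tail (u : nat -> F) (M : R) : u n @[n --> \oo] --> (0 : F) ->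
  (forall n, \sum_(0 <= k < n) absv (u k.+1 - u k) <= M) ->
  exists2 z, l1_tail z = u & abs_sum z <= M.
Proof.
move=> u0 uM.
have [zs zM] := @abs_summable_bounded R s (fun k => u k.+1 - u k) M
  (fun n => (eq_ind_r (fun x : nat -> R => x n <= M) (uM n) (seriesEnat _))).
have zl1 : (fun k => u k.+1 - u k) \in @l1_pred R s by exact/asboolP.
exists (L1 zl1) => //; apply: l1_tail_unique => // k.
by rewrite addrC subrK.
Qed.

(* The coordinates in which [hatA w] is [w] times the backward shift. *)
Definition shift_coord z k : F := k.+1%:R * l1_tail z k.

Lemma shift_coord_linear (a : F) z t k :
  shift_coord (a *: z + t) k = a * shift_coord z k + shift_coord t k.
Proof. by rewrite /shift_coord l1_tail_linear mulrDr mulrCA. Qed.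

Lemma shift_coord0 k : shift_coord 0 k = 0.
Proof.
have := shift_coord_linear 1 0 0 k; rewrite scale1r addr0 mul1r => /esym/eqP.
by rewrite -subr_eq0 addrK => /eqP.
Qed.

Lemma shift_coordZ (a : F) z k : shift_coord (a *: z) k = a * shift_coord z k.
Proof. by have := shift_coord_linear a z 0 k; rewrite addr0 shift_coord0 addr0. Qed.

Lemma shift_coordD z t k : shift_coord (z + t) k = shift_coord z k + shift_coord t k.
Proof. by have := shift_coord_linear 1 z t k; rewrite scale1r mul1r. Qed.

Lemma shift_coordB z t k : shift_coord (z - t) k = shift_coord z k - shift_coord t k.
Proof. by rewrite shift_coordD -scaleN1r shift_coordZ mulN1r. Qed.

Lemma natrS_neq0 k : (k.+1%:R : F) != 0.
Proof. by rewrite pnatr_eq0. Qed.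

Lemma l1_tail_shift_coord z k : l1_tail z k = shift_coord z k / k.+1%:R.
Proof. by rewrite /shift_coord mulrAC divff ?mul1r ?natrS_neq0. Qed.

Lemma l1_seq_shift_coord z k :
  z k = shift_coord z k.+1 / k.+2%:R - shift_coord z k / k.+1%:R.
Proof. by rewrite -!l1_tail_shift_coord l1_tailS addrC addKr. Qed.

Lemma shift_coord_inj z t : shift_coord z =1 shift_coord t -> z = t.
Proof.
move=> zt; apply/val_inj/funext => k /=.
by rewrite !l1_seq_shift_coord !zt.
Qed.

Lemma absv_shift_coord_le z k : absv (shift_coord z k) <= k.+1%:R * abs_sum z.
Proof. by rewrite absvM absv_nat ler_wpM2l // absv_l1_tail_le. Qed.

Lemma bounded_sum_cvg0 (b : nat -> R) (M : R) : (forall k, 0 <= b k) ->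
  (forall n, \sum_(0 <= k < n) b k <= M) -> b n @[n --> \oo] --> 0.
Proof.
move=> b0 bM; apply: cvg_series_cvg_0; apply: nondecreasing_is_cvgn.
  apply/nondecreasing_seqP => n.
  by rewrite !seriesEnat/= big_nat_recr//= lerDl.
by exists M => _ [n _ <-]; rewrite seriesEnat; exact: bM.
Qed.

(** Each [y k / (k + 1)] enters two increments of the tail, whence the factor 2. The condition is
    sufficient only: constant [y] violates it, yet comes from [l1]. *)
Lemma l1_of_shift_coord (y : nat -> F) (M : R) :
  (forall n, \sum_(0 <= k < n) absv (y k) / k.+1%:R <= M) ->
  exists2 z, shift_coord z =1 y & abs_sum z <= 2 * M.
Proof.
move=> yM; pose u k := y k / k.+1%:R.
have uE k : absv (u k) = absv (y k) / k.+1%:R by rewrite absvM absvV absv_nat.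
have u0 : u n @[n --> \oo] --> (0 : F).
  have := @bounded_sum_cvg0 (fun k => absv (u k)) M (fun k => absv_ge0 (u k)).
  have bM n : \sum_(0 <= k < n) absv (u k) <= M.
    by rewrite (eq_bigr _ (fun k _ => uE k)).
  move=> /(_ bM)/cvgrPdist_lt ul; apply/absv_cvgP => e /ul.
  by apply: filterS => n; rewrite !sub0r absvN normrN ger0_norm ?absv_ge0.
have uM n : \sum_(0 <= k < n) absv (u k.+1 - u k) <= 2 * M.
  apply: (@le_trans _ _ (\sum_(0 <= k < n) (absv (u k.+1) + absv (u k)))).
    by apply: ler_sum => k _; rewrite -(absvN (u k)); exact: absvD.
  rewrite big_split /= mulr2n mulrDl mul1r; apply: lerD.
    apply: le_trans (yM n.+1); rewrite big_nat_recl //=.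
    rewrite -(eq_bigr _ (fun k _ => uE k.+1)).
    by rewrite lerDr mulr_ge0 ?absv_ge0 ?invr_ge0.
  by rewrite (eq_bigr _ (fun k _ => uE k)).
have [z zu zM] := l1_of_tail u0 uM.
by exists z => // k; rewrite /shift_coord zu mulrC divfK // natrS_neq0.
Qed.

Lemma abs_sum_le_shift_coord z (M : R) :
  (forall n, \sum_(0 <= k < n) absv (shift_coord z k) / k.+1%:R <= M) ->
  abs_sum z <= 2 * M.
Proof. by move=> /l1_of_shift_coord[t /shift_coord_inj ->]. Qed.

End l1_tails.

(** * The operator and its powers in shift coordinates *)

Lemma hatA_step_identity (K : numFieldType) (i : nat) (w a b : K) :
  w * (i.+3%:R / i.+2%:R * (a + b)) = w * (i.+2%:R / i.+1%:R * a) +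
  w * (i.+3%:R / i.+2%:R * b - (i.+1 * i.+2)%:R^-1 * a).
Proof.
rewrite natrM; have x2 : i.+2%:R != 0 :> K by rewrite pnatr_eq0.
have x1 : i.+1%:R != 0 :> K by rewrite pnatr_eq0.
move: x1 x2; rewrite -![_.+1%:R]natr1; set x : K := i%:R => x1 x2.
by field; rewrite x1 x2.
Qed.

Lemma hatA_iter_identity (K : numFieldType) (k n : nat) (c a b : K) :
  c * ((k + n).+2%:R * (a + b)) / k.+2%:R - c * ((k + n).+1%:R * a) / k.+1%:R =
  c * ((k.+2 + n)%:R / k.+2%:R * b - n%:R / (k.+1 * k.+2)%:R * a).
Proof.
rewrite natrM natrD; have x2 : k.+2%:R != 0 :> K by rewrite pnatr_eq0.
have x1 : k.+1%:R != 0 :> K by rewrite pnatr_eq0.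
move: x1 x2; rewrite -![_.+1%:R]natr1 natrD.
set x : K := k%:R; set m : K := n%:R => x1 x2.
by field; rewrite x1 x2.
Qed.

Section hatA_dynamics.
Variables (R : realType) (s : scalar_kind).
Local Notation F := (scalars R s).
Local Notation l1 := (l1 R s).
Implicit Types z t : l1.

Lemma dominated_cvg0 (C : R) (u v : nat -> F) :
  (forall k, absv (u k) <= C * absv (v k)) ->
  v n @[n --> \oo] --> (0 : F) -> u n @[n --> \oo] --> (0 : F).
Proof.
(* [C] may be zero or negative, so the tolerance is divided by [|C| + 1]. *)
move=> uv v0; have C1 : 0 < `|C| + 1 by rewrite ltr_pwDr.
apply/absv_cvgP => e e0; have := proj1 (absv_cvgP _ _) v0 _ (divr_gt0 e0 C1).
apply: filterS => n; rewrite !sub0r !absvN ltr_pdivlMr // => vn.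
apply: le_lt_trans (uv n) (le_lt_trans _ vn).
rewrite mulrC ler_wpM2l ?absv_ge0 //; have := ler_norm C; lra.
Qed.

(** By uniqueness the tail of [hatA w z] is [w (k + 2) / (k + 1)] times the next tail of [z]: this
    sequence is null, its factor being at most [2 |w|] in modulus, and [hatA_step_identity] checks
    its increments. *)
Lemma shift_coord_hatA (w : F) z k :
  shift_coord (hatA w z) k = w * shift_coord z k.+1.
Proof.
pose u k : F := w * (k.+2%:R / k.+1%:R * l1_tail z k.+1).
rewrite /shift_coord (@l1_tail_unique _ _ _ u) => [||i].
- rewrite /u mulrCA; congr (_ * _).
  by rewrite mulrA mulrCA divff ?mulr1 // natrS_neq0.
- apply: (@dominated_cvg0 (absv w * 2) _ (fun k => l1_tail z k.+1)) => [i|].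
    rewrite !absvM absvV !absv_nat mulrA ler_wpM2r ?absv_ge0 //.
    rewrite ler_wpM2l ?absv_ge0 // ler_pdivrMr ?ltr0n // -natrM ler_nat; lia.
  by have := l1_tail_cvg z; rewrite -(cvg_shiftS (l1_tail z)).
rewrite /u [X in _ = _ + X]/(hatA_coord w z i.+1) /hatA_coord -/(l1_tail z i.+1).
rewrite [l1_coord z i.+2]/= (l1_tailS z i.+1) !addn1 !addn2.
exact: hatA_step_identity.
Qed.

Lemma shift_coord_iter (w : F) n z k :
  shift_coord (iter n (hatA w) z) k = w ^+ n * shift_coord z (k + n).
Proof.
elim: n k => [|n IH] k; first by rewrite expr0 mul1r addn0.
by rewrite iterS shift_coord_hatA IH exprS mulrA addSnnS.
Qed.

Lemma hatA_iter_coord (w : F) n z k :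
  iter n (hatA w) z k = w ^+ n * ((k.+2 + n)%:R / k.+2%:R * z (k + n)%N
    - n%:R / (k.+1 * k.+2)%:R * l1_tail z (k + n)).
Proof.
rewrite l1_seq_shift_coord !shift_coord_iter /shift_coord addSn l1_tailS.
exact: hatA_iter_identity.
Qed.

(** In [hatA_iter_coord] the first factor is at most [n + 1], the tail is at most the norm, and the
    weights [1 / ((k + 1) (k + 2))] telescope to at most 1. The total is [(n + 1) + n]. *)
Lemma abs_sum_hatA_iter (w : F) n z :
  abs_sum (iter n (hatA w) z) <= (2 * n + 1)%:R * absv w ^+ n * abs_sum z.
Proof.
set S := abs_sum z; have S0 : 0 <= S := abs_sum_ge0 z.
apply: abs_sum_le => m.
have bnd k : absv (iter n (hatA w) z k) <= absv w ^+ n *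
    (n.+1%:R * absv (z (k + n)%N) + n%:R * S * (k.+1%:R^-1 - k.+2%:R^-1)).
  rewrite hatA_iter_coord absvM absvX ler_wpM2l ?exprn_ge0 ?absv_ge0 //.
  apply: le_trans (absvD _ _) _; rewrite absvN !absvM !absvV !absv_nat; apply: lerD.
    rewrite ler_wpM2r ?absv_ge0 // ler_pdivrMr ?ltr0n // -natrM ler_nat; lia.
  have -> : k.+1%:R^-1 - k.+2%:R^-1 = (k.+1 * k.+2)%:R^-1 :> R.
    by rewrite natrM; field; rewrite -[1 : R]/(1%:R) -!natrD !pnatr_eq0.
  rewrite mulrAC ler_wpM2r ?invr_ge0 ?ler0n // ler_wpM2l ?ler0n //.
  exact: absv_l1_tail_le.
apply: le_trans (ler_sum _ (fun k _ => bnd k)) _.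
rewrite -mulr_sumr mulrC [leRHS]mulrAC ler_wpM2r ?exprn_ge0 ?absv_ge0 //.
rewrite big_split /= -!mulr_sumr.
have -> : (2 * n + 1)%:R * S = n.+1%:R * S + n%:R * S * 1.
  by rewrite mulr1 -mulrDl -natrD; congr (_%:R * _); lia.
apply: lerD.
  rewrite ler_wpM2l //; apply: le_trans (sum_le_abs_sum z (n + m)).
  rewrite [leRHS](big_cat_nat (n := n)) //= ?leq_addr //.
  rewrite -{4}[n]add0n (big_addn 0 (n + m) n) addKn lerDr.
  by apply: sumr_ge0 => *; exact: absv_ge0.
rewrite ler_wpM2l ?mulr_ge0 // -(opprK (\sum_(0 <= i < m) _)) -sumrN.
under eq_bigr do rewrite opprB.
by rewrite telescope_sumr // opprB invr1 gerBl invr_ge0.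
Qed.

End hatA_dynamics.

(** * Density in norm, boundedness, and the case [|w| < 1] *)

Section density.
Variables (R : realType) (s : scalar_kind).
Local Notation F := (scalars R s).
Local Notation l1 := (l1 R s).
Implicit Types z t : l1.

Lemma l1_denseP (S : set l1) : dense S <->
  forall z (e : R), 0 < e -> exists2 t, S t & abs_sum (z - t) < e.
Proof.
split=> [Sd z e e0 | Sd O [z Oz] Oo].
  have e0' : 0 < of_real s e by rewrite ltr0_of_real.
  have [||t [/= zt St]] := Sd (ball z (of_real s e)).
  - by exists z; exact: ballxx.
  - exact: ball_open.
  exists t => //.
  by move: zt; rewrite -ball_normE /= normr_l1 ltr_of_real.
have [e /= e0 zeO] : nbhs_ball z O.
  by apply/nbhs_ballP; apply: open_nbhs_nbhs.
have [r r0 er] := of_real_gt0 e0.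
have [t St zt] := Sd z r r0; exists t; split=> //.
by apply: zeO; rewrite -ball_normE /= normr_l1 er ltr_of_real.
Qed.

Lemma l1_finite_shift_coord (y : nat -> F) (K : nat) :
  (forall k, (K <= k)%N -> y k = 0) ->
  exists2 z, shift_coord z =1 y &
    abs_sum z <= 2 * \sum_(0 <= k < K) absv (y k) / k.+1%:R.
Proof.
move=> yK; apply: l1_of_shift_coord => n.
have yK0 i : (K <= i)%N -> absv (y i) / i.+1%:R = 0.
  by move=> /yK ->; rewrite absv0 mul0r.
have [nK | /ltnW Kn] := leqP n K.
  rewrite [leRHS](big_cat_nat (n := n)) //= lerDl.
  by apply: sumr_ge0 => *; rewrite divr_ge0 ?absv_ge0.
rewrite (big_cat_nat (n := K)) //= [X in _ + X](_ : _ = 0) ?addr0 //.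
by rewrite big_nat_cond big1 // => i /andP[/andP[Ki _] _]; exact: yK0.
Qed.

Lemma hatA_linear (w : F) : linear (hatA w).
Proof.
move=> a z t; apply: shift_coord_inj => k.
rewrite shift_coord_linear !shift_coord_hatA shift_coord_linear mulrDr.
by rewrite mulrCA.
Qed.

Lemma hatA0 (w : F) : hatA w (0 : l1) = 0.
Proof.
by apply: shift_coord_inj => k; rewrite shift_coord_hatA !shift_coord0 mulr0.
Qed.

Lemma shifted_hatA_linear (w l : F) : linear (@shifted _ l1 (hatA w) l).
Proof.
move=> a z t; rewrite /shifted hatA_linear scalerDr scalerBr !scalerA.
by rewrite (mulrC l) opprD addrACA.
Qed.

Lemma hatA_bounded (w : F) : bounded_operator (hatA w).
Proof.
split; first exact: hatA_linear.
(* The constant 3 is [2 * n + 1] at [n = 1]. *)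
exists (of_real s (3 * absv w)) => z.
by rewrite !normr_l1 -of_realM ler_of_real; exact: (abs_sum_hatA_iter w 1).
Qed.

(** Each of the [n + 1] terms of [1 + q + ... + q^n] is at least [q^n]; multiplied by [1 - q], this
    is the sharper inequality proved by induction. *)
Lemma mulrn_expr_le (q : R) n : 0 <= q <= 1 -> n.+1%:R * q ^+ n * (1 - q) <= 1.
Proof.
move=> /andP[q0 q1]; suff : n.+1%:R * q ^+ n * (1 - q) + q ^+ n.+1 <= 1.
  by have := exprn_ge0 n.+1 q0; lra.
elim: n => [|n IH]; first by rewrite expr0 expr1 !mul1r subrK.
have h : q ^+ n.+1 <= 1 by rewrite exprn_ile1.
rewrite -(natr1 n.+1) (exprS q n.+1).
have := ler_wpM2l q0 IH; have := ler_wpM2r (_ : 0 <= 1 - q) h.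
rewrite subr_ge0 => /(_ q1); rewrite exprS; nra.
Qed.

(** Along the orbit [|y_0|] is at most [(n + 1) |w|^n ||x|| <= C]. A vector with [y_0 = C + 1]
    therefore stays at distance at least 1. *)
Lemma hatA_not_hypercyclic (w : F) : absv w < 1 -> ~ hypercyclic (hatA w).
Proof.
move=> w1 [x [_ /l1_denseP xd]].
have q1 : 0 < 1 - absv w by rewrite subr_gt0.
pose C := abs_sum x / (1 - absv w).
pose c : F := of_real s (C + 1).
have [|t tc _] := @l1_finite_shift_coord (fun k => if k == 0%N then c else 0) 1.
  by case.
have [_ [n _ <-]] := xd t 1 ltr01.
apply/negP; rewrite -leNgt.
have := absv_shift_coord_le (t - iter n (hatA w) x) 0; rewrite mul1r.
apply: le_trans; rewrite shift_coordB tc shift_coord_iter add0n.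
apply: le_trans (lerB_absv _ _).
rewrite absv_of_real ger0_norm ?addr_ge0 ?divr_ge0 ?abs_sum_ge0 ?(ltW q1) //.
rewrite lerBrDr addrC lerD2r absvM absvX ler_pdivlMr //.
have := absv_shift_coord_le x n; set X := abs_sum x => xn.
have wn0 : 0 <= absv w ^+ n by rewrite exprn_ge0 ?absv_ge0.
have := mulrn_expr_le n (_ : 0 <= absv w <= 1); rewrite absv_ge0 (ltW w1).
move=> /(_ isT) /(ler_wpM2r (abs_sum_ge0 x)); rewrite mul1r; apply: le_trans.
rewrite [leRHS]mulrAC ler_wpM2r ?(ltW q1) //.
by rewrite [leRHS]mulrAC mulrC ler_wpM2r.
Qed.

End density.

(** * Divergence of the harmonic series as an obstruction *)

Section harmonic_obstruction.
Variables (R : realType) (s : scalar_kind).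
Local Notation F := (scalars R s).
Local Notation l1 := (l1 R s).
Implicit Types z t : l1.

Lemma sum_progression_le_abs_sum z (N M : nat) : (0 < N)%N ->
  \sum_(0 <= m < M) absv (z (m * N)%N) <= abs_sum z.
Proof.
move=> N0; apply: le_trans (sum_le_abs_sum z (M * N)).
elim: M => [|M IH]; first by rewrite !big_geq.
rewrite big_nat_recr //=.
rewrite [leRHS](big_cat_nat (n := M * N)) //= ?leq_mul2r ?leqnSn ?orbT //.
apply: lerD => //; rewrite big_ltn ?lerDl; last by rewrite ltn_mul2r N0 /=.
by apply: sumr_ge0 => *; exact: absv_ge0.
Qed.

(** Entries of harmonic size along an arithmetic progression would bound the partial harmonic sums
    by a multiple of the norm. *)
Lemma l1_not_harmonic z (c : R) (N m0 : nat) : 0 < c -> (0 < N)%N ->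
  (forall m, (m0 <= m)%N -> c <= (m * N).+2%:R * absv (z (m * N)%N)) -> False.
Proof.
move=> c0 N0 cz; apply: (@dvg_harmonic R).
(* The constant comes from [m N + 2 <= (N + 2) (m + 1)]. *)
have hz m : (m0 <= m)%N -> m.+1%:R^-1 <= N.+2%:R / c * absv (z (m * N)%N).
  move=> /cz czm; rewrite mulrAC ler_pdivlMr // ler_pdivrMl ?ltr0n //.
  apply: le_trans czm _; rewrite mulrA ler_wpM2r ?absv_ge0 // -natrM ler_nat.
  by nia.
apply: nondecreasing_is_cvgn.
  apply/nondecreasing_seqP => n.
  by rewrite !seriesEnat/= big_nat_recr//= lerDl invr_ge0.
exists (\sum_(0 <= m < m0) m.+1%:R^-1 + N.+2%:R / c * abs_sum z) => _ [n _ <-].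
rewrite seriesEnat /=.
apply: (@le_trans _ _ (\sum_(0 <= m < m0 + n) m.+1%:R^-1)).
  rewrite [leRHS](big_cat_nat (n := n)) ?leq_addl //= lerDl.
  by apply: sumr_ge0 => i _; rewrite invr_ge0.
rewrite (big_cat_nat (n := m0)) ?leq_addr //= lerD2l.
apply: (@le_trans _ _ (\sum_(m0 <= m < m0 + n) N.+2%:R / c * absv (z (m * N)%N))).
  by apply: ler_sum_nat => m /andP[/hz].
rewrite -mulr_sumr ler_wpM2l ?divr_ge0 ?(ltW c0) //.
apply: le_trans (sum_progression_le_abs_sum z (m0 + n) N0).
rewrite [leRHS](big_cat_nat (n := m0)) ?leq_addr //= lerDr.
by apply: sumr_ge0 => *; exact: absv_ge0.
Qed.

(** Where the increment of [y] outweighs the correction [y_k / (k + 1)], the entry [z k] has at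
    least harmonic size. *)
Lemma l1_seq_mul_shift_coord z k :
  k.+2%:R * z k = shift_coord z k.+1 - shift_coord z k - shift_coord z k / k.+1%:R.
Proof.
rewrite l1_seq_shift_coord mulrBr mulrCA divff ?natrS_neq0 // mulr1 -addrA -opprD.
congr (_ - _); rewrite -(natr1 k.+1) mulrDl mul1r; congr (_ + _).
by rewrite mulrCA divff ?natrS_neq0 // mulr1.
Qed.

(** At [k = m N] one has [(k + 2) z_k = nu^m (b - a - a / (k + 1))]. If [a != b], its modulus is
    eventually at least [|b - a| / 2], against [l1_not_harmonic]. *)
Lemma shift_coord_progression_eq z (nu a b : F) (N : nat) :
  (0 < N)%N -> 1 <= absv nu ->
  (forall m, shift_coord z (m * N) = nu ^+ m * a) ->
  (forall m, shift_coord z (m * N).+1 = nu ^+ m * b) -> a = b.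
Proof.
move=> N0 nu1 za zb; apply/eqP/negPn/negP => ab.
have d0 : 0 < absv (b - a) by rewrite absv_gt0 subr_eq0 eq_sym.
(* From [m0] on, [|a| / (m N + 1)] is at most [|b - a| / 2]. *)
pose m0 := Num.trunc (2 * absv a / absv (b - a)).
apply: (@l1_not_harmonic z (absv (b - a) / 2) N m0) => // [|m m0m].
  by rewrite divr_gt0.
rewrite -[X in _ <= X * _](absv_nat R s) -absvM l1_seq_mul_shift_coord za zb.
rewrite -mulrBr -mulrA -mulrBr absvM absvX.
apply: (@le_trans _ _ (absv (b - a - a / (m * N).+1%:R))); last first.
  by rewrite ler_peMl ?absv_ge0 // exprn_ege1.
apply: le_trans (lerB_absv _ _); rewrite absvM absvV absv_nat.
have : absv a / (m * N).+1%:R <= absv (b - a) / 2.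
  have := truncnS_gt (2 * absv a / absv (b - a)); rewrite -/m0 ltr_pdivrMr //.
  have : m0.+1%:R <= (m * N).+1%:R :> R.
    by rewrite ler_nat ltnS (leq_trans m0m) // leq_pmulr.
  move=> /(ler_wpM2r (ltW d0)); rewrite ler_pdivrMr ?ltr0n //; lra.
set x := absv a / _; lra.
Qed.

(** For [w != 0] the coordinates are [mu^k y_0] with [mu = l / w] and [|mu| >= 1]. The progression
    of step 1 gives [y_0 = mu y_0], and [mu != 1]. *)
Lemma hatA_eigenvector_eq0 (w l : F) z : absv w <= absv l -> l != w ->
  hatA w z = l *: z -> z = 0.
Proof.
move=> wl lw /(congr1 (fun t => shift_coord t)) E.
have {}E k : w * shift_coord z k.+1 = l * shift_coord z k.
  by rewrite -shift_coord_hatA E shift_coordZ.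
apply: shift_coord_inj => k; rewrite shift_coord0.
have [w0 | w0] := eqVneq w 0.
  have := E k; rewrite w0 mul0r => /esym/eqP; rewrite mulf_eq0 => /orP[|/eqP //].
  by rewrite -{1}w0 (negPf lw).
pose mu := l / w.
have zmu j : shift_coord z j = mu ^+ j * shift_coord z 0.
  elim: j => [|j IH]; first by rewrite mul1r.
  rewrite exprS -mulrA -IH; apply: (mulfI w0).
  by rewrite E (mulrA w) [w * mu]mulrC divfK.
have mu1 : 1 <= absv mu by rewrite absvM absvV ler_pdivlMr ?absv_gt0 // mul1r.
have := @shift_coord_progression_eq z mu (shift_coord z 0) (mu * shift_coord z 0) 1.
move=> /(_ isT mu1) h; have {h} : shift_coord z 0 = mu * shift_coord z 0.
  by apply: h => m; rewrite muln1 zmu // exprSr mulrA.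
move/eqP; rewrite -subr_eq0 -{1}(mul1r (shift_coord z 0)) -mulrBl mulf_eq0.
case/orP => [|/eqP z0]; last by rewrite zmu z0 mulr0.
by rewrite subr_eq0 eq_sym /mu => /eqP m1; rewrite -(divfK w0 l) m1 mul1r eqxx in lw.
Qed.

(** Periodicity gives [y_(m N + j) = w^(- m N) y_j]; the progressions [j = 0] and [j = 1] are
    compared. Periodic points thus lie in a proper closed subspace. *)
Lemma hatA_periodic_point (w : F) z : absv w = 1 -> periodic_point (hatA w) z ->
  shift_coord z 0 = shift_coord z 1.
Proof.
move=> w1 [N N0 zN].
have w0 : w ^+ N != 0 by rewrite expf_neq0 // -absv_gt0 w1.
have E j m : shift_coord z (m * N + j) = (w ^+ N)^-1 ^+ m * shift_coord z j.
  elim: m => [|m IH]; first by rewrite mul1r.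
  rewrite exprS -mulrA -IH; apply: (mulfI w0).
  rewrite mulVKf // -[in RHS]zN shift_coord_iter mulSn.
  by rewrite -addnA addnC.
apply: (@shift_coord_progression_eq z (w ^+ N)^-1 _ _ N) => // [|m|m].
- by rewrite absvV absvX w1 expr1n invr1.
- by rewrite -E addn0.
- by rewrite -E addn1.
Qed.

Lemma hatA_not_chaotic (w : F) : absv w = 1 -> ~ chaotic (hatA w).
Proof.
move=> w1 [_ /l1_denseP pd].
have [|t tc _] := @l1_finite_shift_coord R s (fun k => if k == 1%N then 1 else 0) 2.
  by case=> [|[|]].
(* The functional [y_1 - y_0] has norm at most [2 + 1 = 3]; it vanishes at periodic points and
   equals 1 at [t]. *)
have e0 : 0 < 3^-1 :> R by rewrite invr_gt0 ltr0n.
have [z /= /(hatA_periodic_point w1) z01 /lt_geF/negP] := pd t 3^-1 e0.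
apply; rewrite -[_^-1]mul1r ler_pdivrMr //.
have d0 := absv_shift_coord_le (t - z) 0; have d1 := absv_shift_coord_le (t - z) 1.
apply: (@le_trans _ _ (absv (shift_coord (t - z) 1 - shift_coord (t - z) 0))).
  by rewrite !shift_coordB z01 !tc opprB addrA subrK subr0 absv1.
apply: le_trans (absvD _ _) _; rewrite absvN; lra.
Qed.

End harmonic_obstruction.

(** * Completeness of [l1] and the Neumann series *)

Section neumann_series.
Variables (R : realType) (s : scalar_kind).
Local Notation F := (scalars R s).
Local Notation l1 := (l1 R s).
Implicit Types z t : l1.

Lemma abs_sum_eq0 z : abs_sum z = 0 -> z = 0.
Proof.
move=> z0; apply: shift_coord_inj => k; rewrite shift_coord0.
apply/absv0_eq0/le_anti; rewrite absv_ge0 andbT.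
by have := absv_shift_coord_le z k; rewrite z0 mulr0.
Qed.

Lemma absv_l1_seq_le z k : absv (z k) <= abs_sum z.
Proof.
apply: le_trans (sum_le_abs_sum z k.+1); rewrite big_nat_recr //= lerDr.
by apply: sumr_ge0 => *; exact: absv_ge0.
Qed.

Lemma l1_seq_sum (I : Type) (r : seq I) (u : I -> l1) k :
  (\sum_(i <- r) u i) k = \sum_(i <- r) u i k.
Proof. by elim: r => [|i r IH]; rewrite ?big_nil // !big_cons -IH. Qed.

Lemma abs_sum_sum (I : Type) (r : seq I) (u : I -> l1) :
  abs_sum (\sum_(i <- r) u i) <= \sum_(i <- r) abs_sum (u i).
Proof.
elim: r => [|i r IH]; first by rewrite !big_nil abs_sum0.
by rewrite !big_cons; apply: le_trans (abs_sumD _ _) _; rewrite lerD2l.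
Qed.

(** The sum is formed entry by entry, and the norm of the remainder after [J] terms is bounded by
    the remainder [limn b - b J] of the series of norms. *)
Lemma l1_series_cvg (u : nat -> l1) (M : R) :
  (forall J, \sum_(0 <= j < J) abs_sum (u j) <= M) ->
  exists2 v : l1, abs_sum v <= M &
    abs_sum (v - \sum_(0 <= j < J) u j) @[J --> \oo] --> (0 : R).
Proof.
move=> uM; pose b : nat -> R := series (fun j => abs_sum (u j)).
have bc : cvgn b.
  apply: nondecreasing_is_cvgn.
    apply/nondecreasing_seqP => n.
    by rewrite /b !seriesEnat/= big_nat_recr//= lerDl abs_sum_ge0.
  by exists M => _ [n _ <-]; rewrite /b seriesEnat; exact: uM.
have b_nd : {homo b : m n / (m <= n)%N >-> m <= n}.
  apply/nondecreasing_seqP => n.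
  by rewrite /b !seriesEnat/= big_nat_recr//= lerDl abs_sum_ge0.
pose v k : F := limn (series (fun j => u j k : F)).
have vk k : series (fun j => u j k : F) n @[n --> \oo] --> v k.
  apply: abs_summable_cvg; apply: (proj1 (@abs_summable_bounded _ _ _ M _)) => n.
  rewrite seriesEnat; apply: le_trans (uM n).
  by apply: ler_sum => j _; exact: absv_l1_seq_le.
pose S J := \sum_(0 <= j < J) u j.
have SE J k : S J k = series (fun j => u j k : F) J by rewrite /S l1_seq_sum seriesEnat.
have near_v K (e : R) : 0 < e -> \forall n \near \oo,
    \sum_(0 <= k < K) absv (v k - S n k) < e.
  elim: K e => [|K IH] e e0; first by near=> n; rewrite big_geq.
  have e2 : 0 < e / 2 by rewrite divr_gt0.
  have h := proj1 (absv_cvgP _ _) (vk K) _ e2.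
  near=> n; rewrite big_nat_recr //= [ltRHS]splitr; apply: ltrD.
    by near: n; exact: IH.
  by rewrite SE; near: n.
have Sdiff J n : (J <= n)%N -> abs_sum (S n - S J) <= b n - b J.
  move=> Jn; rewrite /S /b !seriesEnat /= (big_cat_nat (n := J)) //=.
  rewrite [X in _ <= X - _](big_cat_nat (n := J)) //=.
  have aK (V : zmodType) (x y : V) : x + y - x = y by rewrite addrC addKr.
  by rewrite !aK; exact: abs_sum_sum.
(* On [K] entries a far partial sum replaces [v] up to [e]; the resulting bound does not depend on
   [K], so it bounds the whole norm. *)
have vS J K : \sum_(0 <= k < K) absv (v k - S J k) <= limn b - b J.
  apply/ler_addgt0Pr => e e0.
  have [n _ /(_ (n + J)%N)] := near_v K e e0; rewrite /= leq_addr => /(_ isT) hn.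
  have := le_trans (Sdiff J (n + J)%N (leq_addl _ _))
    (lerB (nondecreasing_cvgn_le b_nd bc (n + J)) (lexx (b J))).
  have : \sum_(0 <= k < K) absv (S (n + J)%N k - S J k : F) <=
    abs_sum (S (n + J)%N - S J) by exact: (sum_le_abs_sum (S (n + J)%N - S J) K).
  have : \sum_(0 <= k < K) absv (v k - S J k) <=
    \sum_(0 <= k < K) absv (v k - S (n + J)%N k) +
    \sum_(0 <= k < K) absv (S (n + J)%N k - S J k : F).
    rewrite -big_split /=; apply: ler_sum => k _.
    apply: le_trans (absvD _ _).
    by rewrite addrA subrK.
  by lra.
have vl1 : v \in @l1_pred R s.
  apply/asboolP; apply: (proj1 (@abs_summable_bounded _ _ _ (limn b - b 0) _)) => n.
  rewrite seriesEnat; apply: le_trans (vS 0%N n); apply: ler_sum => k _.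
  by rewrite SE seriesEnat /= big_geq // subr0.
exists (L1 vl1).
  apply: abs_sum_le => n; apply: (@le_trans _ _ (limn b)).
    apply: le_trans (_ : limn b - b 0 <= _); last first.
      by rewrite /b seriesEnat /= big_geq // subr0.
    apply: le_trans (vS 0%N n); apply: ler_sum => k _.
    by rewrite SE seriesEnat /= big_geq // subr0.
  by apply: limr_le => //; near=> m; rewrite /b seriesEnat; exact: uM.
apply: (@squeeze_cvgr _ _ _ _ (fun=> 0) (fun J => limn b - b J)).
- near=> J; rewrite abs_sum_ge0 /=.
  by apply: (@abs_sum_le R s (L1 vl1 - S J)) => n; exact: vS.
- exact: cvg_cst.
- by rewrite -[X in _ --> X](subrr (limn b)); apply: cvgB => //; exact: cvg_cst.
Unshelve. all: by end_near. Qed.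

Lemma sum_mulrn_expr_le (q : R) J : 0 <= q < 1 ->
  \sum_(0 <= j < J) (2 * j + 1)%:R * q ^+ j <= 2 / (1 - q) ^+ 2.
Proof.
move=> /andP[q0 q1]; have q2 : 0 < (1 - q) ^+ 2 by rewrite exprn_gt0 // subr_gt0.
(* Closed form of the truncated derivative of the geometric series; it is used with
   [2 j + 1 <= 2 (j + 1)]. *)
have E : (\sum_(0 <= j < J) j.+1%:R * q ^+ j) * (1 - q) ^+ 2 =
    1 - q ^+ J * (J.+1%:R - J%:R * q).
  elim: J => [|J IH]; first by rewrite big_geq // mul0r expr0 mul0r subr0 mulr1 subrr.
  rewrite big_nat_recr //= mulrDl IH (exprS q J) -(natr1 J.+1) -(natr1 J).
  by set x := J%:R; set y := q ^+ J; ring.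
rewrite ler_pdivlMr //.
apply: (@le_trans _ _ (2 * (1 - q ^+ J * (J.+1%:R - J%:R * q)))).
  rewrite -E [leRHS]mulrA ler_wpM2r ?(ltW q2) // mulr_sumr; apply: ler_sum => j _.
  by rewrite mulrA -natrM ler_wpM2r ?exprn_ge0 // ler_nat; lia.
rewrite ger_pMr // gerBl mulr_ge0 ?exprn_ge0 // subr_ge0 -natr1.
have : 0 <= J%:R :> R by [].
nra.
Qed.

(** The solution is the series of [- l^-(j + 1) A^j g], which converges by [abs_sum_hatA_iter]. One
    [C] for all [g] later makes the inverse bounded. *)
Lemma hatA_shifted_solvable (w l : F) : absv w < absv l ->
  exists C : R, forall g : l1,
    exists2 f, shifted (hatA w) l f = g & abs_sum f <= C * abs_sum g.
Proof.
move=> wl; have l0 : 0 < absv l by apply: le_lt_trans wl; exact: absv_ge0.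
have ln0 : l != 0 by rewrite -absv_gt0.
pose q := absv w / absv l.
have q01 : 0 <= q < 1.
  by rewrite divr_ge0 ?absv_ge0 //= ltr_pdivrMr // mul1r.
exists ((absv l)^-1 * (2 / (1 - q) ^+ 2)) => g.
pose u j := - (l^-1 ^+ j.+1) *: iter j (hatA w) g.
have uM J : \sum_(0 <= j < J) abs_sum (u j) <=
    (absv l)^-1 * (2 / (1 - q) ^+ 2) * abs_sum g.
  apply: (@le_trans _ _
    (\sum_(0 <= j < J) (absv l)^-1 * ((2 * j + 1)%:R * q ^+ j) * abs_sum g)).
    apply: ler_sum => j _; rewrite abs_sumZ absvN absvX absvV exprS.
    rewrite -!mulrA ler_wpM2l ?invr_ge0 ?absv_ge0 //.
    apply: le_trans (ler_wpM2l _ (abs_sum_hatA_iter w j g)) _.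
      by rewrite exprn_ge0 ?invr_ge0 ?absv_ge0.
    by rewrite /q exprMn le_eqVlt; apply/orP; left; apply/eqP; ring.
  rewrite -mulr_suml -mulr_sumr ler_wpM2r ?abs_sum_ge0 //.
  by rewrite ler_wpM2l ?invr_ge0 ?absv_ge0 // sum_mulrn_expr_le.
have [v vM vu] := l1_series_cvg uM; exists v => //.
have lin := shifted_hatA_linear w l.
have shD x y : shifted (hatA w) l (x + y) = shifted (hatA w) l x + shifted (hatA w) l y.
  by have := lin 1 x y; rewrite !scale1r.
have sh0 : shifted (hatA w) l 0 = 0 by rewrite /shifted hatA0 scaler0 subr0.
have shZ a x : shifted (hatA w) l (a *: x) = a *: shifted (hatA w) l x.
  by have := lin a x 0; rewrite sh0 !addr0.
have shS J : shifted (hatA w) l (\sum_(0 <= j < J) u j) =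
    g - l^-1 ^+ J *: iter J (hatA w) g.
  elim: J => [|J IH].
    by rewrite big_geq // expr0 scale1r subrr.
  rewrite big_nat_recr //= shD IH /u shZ /shifted scalerBr scalerA mulNr.
  rewrite {2}exprSr -mulrA mulVf // mulr1 !scaleNr opprK.
  by rewrite [X in _ + X]addrC addrA subrK.
apply/eqP; rewrite -subr_eq0; apply/eqP/abs_sum_eq0/le_anti.
rewrite abs_sum_ge0 andbT; apply/ler_addgt0Pr => e e0; rewrite add0r.
have C0 : 0 < 3 * absv w + absv l by rewrite ltr_wpDl ?mulr_ge0 ?absv_ge0.
have u0 := @bounded_sum_cvg0 _ (fun j => abs_sum (u j)) _
  (fun j => abs_sum_ge0 (u j)) uM.
have e1 : 0 < e / 2 / (3 * absv w + absv l) by rewrite !divr_gt0.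
have e2 : 0 < e / 2 / absv l by rewrite !divr_gt0.
have [J [hv hu]] : exists J,
    abs_sum (v - \sum_(0 <= j < J) u j) < e / 2 / (3 * absv w + absv l) /\
    abs_sum (u J) < e / 2 / absv l.
  near \oo => J; exists J; split.
    have : `|0 - abs_sum (v - \sum_(0 <= j < J) u j)| < e / 2 / (3 * absv w + absv l).
      by near: J; exact: cvgr_dist_lt vu _ e1.
    by rewrite sub0r normrN ger0_norm ?abs_sum_ge0.
  have : `|0 - abs_sum (u J)| < e / 2 / absv l.
    by near: J; exact: cvgr_dist_lt u0 _ e2.
  by rewrite sub0r normrN ger0_norm ?abs_sum_ge0.
(* The defect [- l^-J A^J g] of the partial sum is [l] times the next term [u J], hence small. *)
have -> : shifted (hatA w) l v - g =
    shifted (hatA w) l (v - \sum_(0 <= j < J) u j) + l *: u J.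
  rewrite -{1}(subrK (\sum_(0 <= j < J) u j) v) shD shS /u scalerA exprS.
  by rewrite mulrN mulrA divff // mul1r scaleNr addrA addrAC addrK addrC.
apply: le_trans (abs_sumD _ _) _; rewrite abs_sumZ.
have : abs_sum (shifted (hatA w) l (v - \sum_(0 <= j < J) u j)) <=
   (3 * absv w + absv l) * abs_sum (v - \sum_(0 <= j < J) u j).
  rewrite /shifted; apply: le_trans (abs_sumD _ _) _.
  rewrite abs_sumN abs_sumZ mulrDl lerD2r.
  exact: (abs_sum_hatA_iter w 1).
move: hv hu; rewrite !ltr_pdivlMr //; lra.
Unshelve. all: by end_near. Qed.

End neumann_series.

(** * Finitely supported coordinates and a countable dense family *)

Section finite_approximation.
Variables (R : realType) (s : scalar_kind).
Local Notation F := (scalars R s).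
Local Notation l1 := (l1 R s).
Implicit Types z t : l1.

(** The approximant keeps the first [K] entries of [z] and replaces the others by zero. It is
    described by its tails [u], which vanish from [K] on. *)
Lemma l1_finite_dense z (e : R) : 0 < e -> exists K, exists2 t,
  (forall k, (K <= k)%N -> shift_coord t k = 0) & abs_sum (z - t) < e.
Proof.
move=> e0.
have zc : series (fun k => absv (z k)) n @[n --> \oo] --> abs_sum z := l1_summable z.
have /cvgrPdist_lt/(_ e e0)[K _ /(_ K (leqnn K))] := zc.
rewrite /= seriesEnat => zK.
pose u k : F := l1_tail z (minn k K) - l1_tail z K.
have uK k : (K <= k)%N -> u k = 0 by move=> /minn_idPr Kk; rewrite /u Kk subrr.
have uS k : u k.+1 - u k = if (k < K)%N then z k else 0.
  case: ltnP => kK; last by rewrite !uK ?subrr // leqW.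
  rewrite /u (minn_idPl kK) (minn_idPl (ltnW kK)) opprB addrA subrK l1_tailS.
  by rewrite addrC addKr.
have u0 : u n @[n --> \oo] --> (0 : F).
  by apply: cvg_near_cst; exists K.
have [|t tu _] := @l1_of_tail _ _ u (abs_sum z) u0.
  move=> n; apply: le_trans (sum_le_abs_sum z n); apply: ler_sum => k _.
  by rewrite uS; case: ifP; rewrite ?absv0 ?absv_ge0.
exists K, t; first by move=> k Kk; rewrite /shift_coord tu uK // mulr0.
have zt k : absv ((z - t) k) = if (k < K)%N then 0 else absv (z k).
  have -> : absv ((z - t) k) = absv (z k - t k : F) by [].
  have -> : t k = u k.+1 - u k by rewrite -tu l1_tailS addrC addKr.
  by rewrite uS; case: ifP => _; rewrite ?subrr ?absv0 ?subr0.
apply: le_lt_trans zK.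
have zK0 : \sum_(0 <= k < K) absv (z k) <= abs_sum z by exact: sum_le_abs_sum.
rewrite ger0_norm ?subr_ge0 //; apply: (@abs_sum_le R s (z - t)) => n; rewrite lerBrDr.
apply: le_trans (sum_le_abs_sum z (maxn n K)).
rewrite addrC [leRHS](big_cat_nat (n := K)) ?leq_maxr //= lerD2l.
have [nK | /ltnW Kn] := leqP n K.
  rewrite [leRHS]big_geq // big_nat_cond big1 // => k /andP[/andP[_ kn] _].
  by rewrite zt (leq_trans kn nK).
rewrite (big_cat_nat (n := K)) //= [X in X + _](_ : _ = 0) ?add0r.
  by apply: ler_sum_nat => k /andP[Kk _]; rewrite zt ltnNge Kk.
by rewrite big_nat_cond big1 // => k /andP[/andP[_ kK] _]; rewrite zt kK.
Qed.

(** Pairs serve for both fields, so that one countable type parametrizes a dense set of scalars. *)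
Definition rat_scalar (q : rat * rat) : F :=
  match s as s' return scalars R s' with
  | real_scalars => ratr q.1
  | complex_scalars => Complex (ratr q.1) (ratr q.2)
  end.

Lemma rat_scalar_dense (x : F) (e : R) : 0 < e ->
  exists q, absv (x - rat_scalar q) < e.
Proof.
have real_dense (a : R) (d : R) : 0 < d -> exists q : rat, `|a - ratr q| < d.
  move=> d0; have [|q] := @rat_in_itvoo R (a - d) (a + d); first by lra.
  by rewrite in_itv /= => /andP[aq qa]; exists q; rewrite ltr_norml; lra.
rewrite /rat_scalar; case: s x => [x|[a b]] e0 /=.
  by have [q xq] := real_dense x e e0; exists (q, q).
have e2 : 0 < e / 2 by rewrite divr_gt0.
have [q aq] := real_dense a _ e2; have [r br] := real_dense b _ e2.
exists (q, r); apply: le_lt_trans (normc_le_Re_Im _ _) _.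
by rewrite [ltRHS]splitr ltrD.
Qed.

Lemma injective_unbounded (f : nat -> nat) (m : nat) : injective f ->
  exists j, (m <= f j)%N.
Proof.
move=> finj; apply/not_existsP => h.
have := @uniq_leq_size _ (map f (iota 0 m.+1)) (iota 0 m).
rewrite map_inj_uniq // iota_uniq => /(_ isT); rewrite size_map !size_iota ltnn.
move=> h'; suff : false by [].
apply: h' => _ /mapP[j _ ->]; rewrite mem_iota add0n ltnNge.
by apply/negP; exact: h.
Qed.

(** Approximation by members of arbitrarily large index is required because the error of the
    hypercyclic vector at stage [i] is [2^-i]. *)
Lemma l1_finite_enumeration : exists (D : nat -> nat -> F) (K : nat -> nat),
  (forall i k, (K i <= k)%N -> D i k = 0) /\
  forall z (e : R) m, 0 < e -> exists2 i, (m <= i)%N &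
    exists2 t, shift_coord t =1 D i & abs_sum (z - t) < e.
Proof.
(* The number paired with each list makes the list occur at infinitely many indices. Indices that
   code nothing give the zero vector. *)
pose code i := odflt (0%N, [::]) (unpickle i : option (nat * seq (rat * rat))).
pose K i := size (code i).2.
pose D i k := if (k < K i)%N then rat_scalar (nth (0, 0) (code i).2 k) else 0.
exists D, K; split=> [i k Kk | z e m e0]; first by rewrite /D ltnNge Kk.
have e2 : 0 < e / 2 by rewrite divr_gt0.
have [N [t tN zt]] := l1_finite_dense z e2.
(* [N] coordinates with this tolerance, doubled by [l1_finite_shift_coord], cost at most [e / 2]. *)
have d0 : 0 < e / 2 / (2 * N.+1%:R) by rewrite !divr_gt0 ?mulr_gt0.
have [q tq] := choice (fun k => rat_scalar_dense (shift_coord t k) d0).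
pose d := mkseq q N.
have [|j mj] := @injective_unbounded (fun j => pickle (j, d)) m.
  by move=> i j /(pcan_inj pickleK)[].
exists (pickle (j, d)) => //; set i := pickle _.
have ci : code i = (j, d) by rewrite /code pickleK.
have DE k : D i k = if (k < N)%N then rat_scalar (q k) else 0.
  by rewrite /D /K ci /= size_mkseq; case: ifP => // kN; rewrite nth_mkseq.
have [|t' t'D _] := @l1_finite_shift_coord _ _ (D i) N.
  by move=> k Nk; rewrite DE ltnNge Nk.
exists t' => //.
have tt'0 k : (N <= k)%N -> shift_coord (t - t') k = 0.
  by move=> Nk; rewrite shift_coordB t'D DE ltnNge Nk tN // subr0.
have tt' : abs_sum (t - t') <= e / 2.
  have [t'' t''E] := l1_finite_shift_coord tt'0.
  rewrite (shift_coord_inj t''E) => /le_trans -> //.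
  apply: (@le_trans _ _ (2 * \sum_(0 <= k < N) e / 2 / (2 * N.+1%:R))).
    rewrite ler_wpM2l //; apply: ler_sum_nat => k /andP[_ kN].
    rewrite shift_coordB t'D DE kN; apply: le_trans (ltW (tq k)).
    by rewrite ler_pdivrMr ?ltr0n // ler_peMr ?absv_ge0 // ler1n.
  rewrite sumr_const_nat subn0 -(mulr_natr _ N).
  have -> : 2 * (e / 2 / (2 * N.+1%:R) * N%:R) = e / 2 * (N%:R / N.+1%:R).
    by field; rewrite ?natr1 ?nat1r pnatr_eq0.
  by rewrite ler_piMr ?(ltW e2) // ler_pdivrMr ?ltr0n // mul1r ler_nat.
have -> : z - t' = (z - t) + (t - t') by rewrite addrA subrK.
by apply: le_lt_trans (abs_sumD _ _) _; rewrite [ltRHS]splitr ltr_leD.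
Qed.

End finite_approximation.

(** * Construction of a hypercyclic vector for [|w| >= 1] *)

Section hypercyclicity.
Variables (R : realType) (s : scalar_kind).
Local Notation F := (scalars R s).
Local Notation l1 := (l1 R s).
Implicit Types z t u : l1.

(** From position [m] on the weights are at most [1 / (m + 1)], so a finite vector moved far out
    becomes small in norm. *)
Lemma sum_shifted_block_le (d : nat -> F) (c : F) (K m n : nat) :
  (forall k, (K <= k)%N -> d k = 0) -> absv c <= 1 ->
  \sum_(0 <= k < n) absv (if (m <= k)%N then c * d (k - m)%N else 0) / k.+1%:R <=
  (\sum_(0 <= k < K) absv (d k)) / m.+1%:R.
Proof.
move=> dK c1; rewrite mulr_suml.
apply: (@le_trans _ _ (\sum_(0 <= k < m + K + n)
    absv (if (m <= k)%N then c * d (k - m)%N else 0) / k.+1%:R)).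
  rewrite [leRHS](big_cat_nat (n := n)) ?leq_addl //= lerDl.
  by apply: sumr_ge0 => *; rewrite divr_ge0 ?absv_ge0.
rewrite -addnA (big_cat_nat (n := m)) ?leq_addr //= [X in X + _](_ : _ = 0) ?add0r.
  rewrite -{1}[m]add0n (big_addn 0 (m + (K + n)) m) addKn.
  rewrite (big_cat_nat (n := K)) ?leq_addr //= [X in _ + X](_ : _ = 0) ?addr0.
    apply: ler_sum => k _; rewrite leq_addl addnK absvM.
    apply: ler_pM; rewrite ?mulr_ge0 ?absv_ge0 ?invr_ge0 //.
      by rewrite ler_piMl ?absv_ge0.
    by rewrite lef_pV2 ?posrE ?ltr0n // ler_nat ltnS leq_addl.
  rewrite big_nat_cond big1 // => k /andP[/andP[Kk _] _].
  by rewrite leq_addl addnK dK // mulr0 absv0 mul0r.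
rewrite big_nat_cond big1 // => k /andP[/andP[_ km] _].
by rewrite leqNgt km absv0 mul0r.
Qed.

Lemma sum_expr_half_le (a b : nat) : \sum_(a <= j < b) (2^-1 : R) ^+ j.+1 <= 2^-1 ^+ a.
Proof.
have [ba | /ltnW ab] := leqP b a; first by rewrite big_geq // exprn_ge0 // invr_ge0.
have E : \sum_(a <= j < b) (2^-1 : R) ^+ j.+1 = 2^-1 ^+ a - 2^-1 ^+ b.
  rewrite -opprB -(telescope_sumr (fun j => (2^-1 : R) ^+ j)) // -sumrN.
  by apply: eq_bigr => j _; rewrite exprS; field.
by rewrite E gerBl exprn_ge0 // invr_ge0.
Qed.

(** [K i] is the length of block [i] and [C j] the gap required before block [j]. As [n i >= i],
    only finitely many blocks start at or before any given coordinate. *)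
Lemma sparse_positions (K C : nat -> nat) : exists n : nat -> nat,
  (forall i, (i + C i <= n i)%N) /\
  (forall i j, (i < j)%N -> (n i + K i + C j <= n j)%N).
Proof.
pose n i := (C 0 + \sum_(0 <= j < i) (K j + C j.+1).+1)%N.
have nS i : n i.+1 = (n i + (K i + C i.+1).+1)%N by rewrite /n big_nat_recr //= addnA.
have nC i : (i + C i <= n i)%N.
  by elim: i => [|i IH]; [rewrite /n big_geq // addn0 | rewrite nS; lia].
exists n; split=> // i; elim=> // j IH; rewrite ltnS leq_eqVlt => /orP[/eqP ->|/IH].
  by rewrite nS; lia.
by rewrite nS; lia.
Qed.

Lemma abs_sum_distD z t u : abs_sum (z - u) <= abs_sum (z - t) + abs_sum (u - t).
Proof.
have -> : z - u = (z - t) - (u - t) by rewrite opprB addrA subrK.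
by rewrite -(abs_sumN (u - t)); exact: abs_sumD.
Qed.

Lemma dense_orbit_neq0 (w : F) (p : nat) z :
  dense [set iter n (iter p (hatA w)) z | n in [set: nat]] -> z != 0.
Proof.
move=> /l1_denseP zd; apply/eqP => z0.
have [|t t1 _] := @l1_finite_shift_coord R s (fun k => if k == 0%N then 1 else 0) 1.
  by case.
have [_ [n _ <-]] := zd t 1 ltr01; rewrite z0 -iterM.
have -> : iter (n * p) (hatA w) (0 : l1) = 0.
  by elim: (n * p)%N => // m IH; rewrite iterS IH hatA0.
rewrite subr0 ltNge => /negP; apply.
by have := absv_shift_coord_le t 0; rewrite t1 absv1 mul1r.
Qed.

(* The hypercyclic vector is a sum of shifted copies of the finite vectors
   [D i], put so far apart that the copies not yet reached stay negligible. *)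
Lemma hatA_hypercyclic (w : F) (p : nat) : 1 <= absv w -> (0 < p)%N ->
  hypercyclic (iter p (hatA w)).
Proof.
move=> w1 p0; have w0 : w != 0 by rewrite -absv_gt0 (lt_le_trans ltr01).
have [D [K [DK Ddense]]] := l1_finite_enumeration R s.
pose L i := \sum_(0 <= k < K i) absv (D i k).
have L0 i : 0 <= L i by apply: sumr_ge0 => *; exact: absv_ge0.
(* At distance [C i] the weighted sum of block [i] drops to [2^-(i + 1)]. *)
pose C i := (Num.trunc (2 ^+ i.+1 * L i)).+1.
have [n [nC nK]] := sparse_positions K C.
(* Multiples of [p], so that [m i] steps of [hatA w] are [n i] steps of its [p]-th power. *)
pose m i := (n i * p)%N.
have mK i j : (i < j)%N -> (m i + K i + C j <= m j)%N.
  by move=> /nK; rewrite /m => h; nia.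
have LC i a : (C i <= a)%N -> L i / a.+1%:R <= 2^-1 ^+ i.+1.
  move=> Ca; rewrite ler_pdivrMr ?ltr0n // exprVn ler_pdivlMl ?exprn_gt0 //.
  apply: (le_trans (ltW (truncnS_gt _))); rewrite ler_nat.
  by apply: leq_trans Ca _.
have wV a : absv (w ^- a) <= 1.
  by rewrite absvV absvX invf_le1 ?exprn_ege1 // exprn_gt0 // (lt_le_trans ltr01).
(* The factor [w^- m i] cancels the growth over [m i] steps, which bring block [i] back to exactly
   [D i]. *)
pose v i k := if (m i <= k)%N then w ^- m i * D i (k - m i)%N else 0.
pose y k := \sum_(0 <= i < k.+1) v i k.
have yE k J : (k < J)%N -> y k = \sum_(0 <= i < J) v i k.
  move=> kJ; rewrite [RHS](big_cat_nat (n := k.+1)) //=.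
  rewrite [X in _ + X](_ : _ = 0) ?addr0 //.
  rewrite big_nat_cond big1 // => i /andP[/andP[ki _] _].
  rewrite /v ifF //; apply/negbTE; rewrite -ltnNge.
  by have := nC i; rewrite /m; nia.
(* One estimate serves twice: for the existence of [x], and for the blocks not yet reached after
   [m i] steps. *)
have blocks (c : nat -> F) (a : nat -> nat) (i J N : nat) :
    (forall j, (i <= j)%N -> absv (c j) <= 1 /\ (C j <= a j)%N) ->
    \sum_(0 <= k < N) absv (\sum_(i <= j < J)
      if (a j <= k)%N then c j * D j (k - a j)%N else 0) / k.+1%:R <= 2^-1 ^+ i.
  move=> ca; apply: le_trans (sum_expr_half_le i J).
  apply: (@le_trans _ _ (\sum_(0 <= k < N) \sum_(i <= j < J)
      absv (if (a j <= k)%N then c j * D j (k - a j)%N else 0) / k.+1%:R)).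
    apply: ler_sum => k _; rewrite -mulr_suml ler_wpM2r ?invr_ge0 //.
    exact: absv_sum.
  rewrite exchange_big_nat /=; apply: ler_sum_nat => j /andP[ij _].
  have [c1 Ca] := ca j ij; apply: le_trans (LC j _ Ca).
  by apply: sum_shifted_block_le => //; exact: DK.
have [|x xy _] := @l1_of_shift_coord R s y 1.
  move=> N; rewrite -(expr0 (2^-1 : R)).
  under eq_big_nat => k /andP[_ kN] do rewrite (yE k N kN).
  apply: (blocks (fun j => w ^- m j) m) => j _; split=> //.
  by have := nC j; rewrite /m; nia.
have xd : dense [set iter n (iter p (hatA w)) x | n in [set: nat]].
  apply/l1_denseP => z e e0.
  have e2 : 0 < e / 2 by rewrite divr_gt0.
  pose i0 := Num.trunc (e / 2)^-1.
  have hi0 : 2^-1 ^+ i0 <= e / 2.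
    rewrite exprVn -[leRHS]invrK lef_pV2 ?posrE ?exprn_gt0 ?invr_gt0 //.
    apply: le_trans (ltW (truncnS_gt _)) _.
    by rewrite -natrX ler_nat; exact: ltn_expl.
  have [i i0i [t tD zt]] := Ddense z (e / 2) i0 e2.
  exists (iter (n i) (iter p (hatA w)) x); first by exists (n i).
  rewrite -iterM -/(m i).
  (* The later blocks have weighted sum at most [2^-(i + 1)], which the passage to the norm
     doubles. *)
  have tail_bound : abs_sum (iter (m i) (hatA w) x - t) <= 2^-1 ^+ i.
    rewrite -[leRHS](mulVKf (_ : 2 != 0 :> R)) ?pnatr_eq0 // -exprS.
    apply: abs_sum_le_shift_coord => N.
    (* After [m i] steps the blocks before [i] have been shifted out, block [i] cancels [t], and
       block [j > i] starts at [m j - m i]. *)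
    have E k J : (k + m i < J)%N -> (i < J)%N ->
       shift_coord (iter (m i) (hatA w) x - t) k =
       \sum_(i.+1 <= j < J) if (m j - m i <= k)%N
         then w ^- (m j - m i) * D j (k - (m j - m i))%N else 0.
      move=> kJ iJ; rewrite shift_coordB shift_coord_iter xy tD (yE _ J kJ).
      rewrite mulr_sumr (big_cat_nat (n := i)) ?(ltnW iJ) //=.
      rewrite [X in X + _ - _](_ : _ = 0) ?add0r; last first.
        rewrite big_nat_cond big1 // => j /andP[/andP[_ ji] _].
        rewrite /v; case: ifP => _; last by rewrite mulr0.
        by rewrite DK ?mulr0 //; have := mK j i ji; lia.
      rewrite big_ltn // {1}/v leq_addl addnK mulVKf ?expf_neq0 // addrC addrK.
      apply: eq_big_nat => j /andP[ij _]; have := mK i j ij => mij.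
      rewrite /v leq_subLR addnC; case: ifP => kmj; last by rewrite mulr0.
      rewrite mulrA; congr (_ * D j _); last by lia.
      have -> : w ^+ m j = w ^+ m i * w ^+ (m j - m i).
        by rewrite -exprD subnKC //; lia.
      by rewrite invfM mulrA divff ?mul1r // expf_neq0.
    under eq_big_nat => k /andP[_ kN].
      rewrite (E k (N + m i + i.+1)%N); [over | lia | lia].
    apply: (blocks (fun j => w ^- (m j - m i))
                   (fun j => m j - m i)%N) => j ij; split=> //.
    by have := mK i j ij; lia.
  have half_le : 2^-1 ^+ i <= e / 2.
    apply: le_trans hi0.
    by rewrite ler_wiXn2l // ?invr_ge0 // invf_le1 ?ler1n.
  have := ltr_leD zt (le_trans tail_bound half_le); rewrite -splitr.
  exact: le_lt_trans (abs_sum_distD _ _ _).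
by exists x; split=> //; exact: dense_orbit_neq0 xd.
Qed.

End hypercyclicity.

(** * Periodic points for [|w| > 1], and the equation [(A - l) f = g] *)

Lemma resonance_identity (K : comPzRingType) (m x a b r : K) :
  m * x * (a + (b + r)) - x * (a + b) - x * (a + b) * r =
  x * ((m - 1) * (a + b) - ((a + b) * r - m * r)).
Proof. by ring. Qed.

Section chaos_and_spectrum.
Variables (R : realType) (s : scalar_kind).
Local Notation F := (scalars R s).
Local Notation l1 := (l1 R s).
Implicit Types z t u : l1.

Lemma sum_expr_le (q : R) n : 0 <= q < 1 -> \sum_(0 <= k < n) q ^+ k <= (1 - q)^-1.
Proof.
move=> /andP[q0 q1]; have q1' : 0 < 1 - q by rewrite subr_gt0.
rewrite -[leRHS]mul1r ler_pdivlMr //.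
have -> : (\sum_(0 <= k < n) q ^+ k) * (1 - q) = 1 - q ^+ n.
  elim: n => [|n IH]; first by rewrite big_geq // mul0r subrr.
  by rewrite big_nat_recr //= mulrDl IH exprS; ring.
by rewrite gerBl exprn_ge0.
Qed.

(** A finite vector [t] is repeated with period [N], each copy scaled by a further [w^-N]; the
    result [f] is fixed by the [N]-th power. The added copies have weighted sum at most
    [C / (N + 1)]. *)
Lemma hatA_periodic_dense (w : F) : 1 < absv w ->
  dense [set z : l1 | periodic_point (hatA w) z].
Proof.
move=> w1; have w0 : w != 0 by rewrite -absv_gt0 (lt_trans ltr01).
pose q := (absv w)^-1.
have q01 : 0 <= q < 1 by rewrite invr_ge0 absv_ge0 invf_lt1 // (lt_trans ltr01).
have q1 : 0 < 1 - q by case/andP: q01; rewrite subr_gt0.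
apply/l1_denseP => z e e0; have e2 : 0 < e / 2 by rewrite divr_gt0.
have [K [t tK zt]] := l1_finite_dense z e2.
pose M := \sum_(0 <= k < K) absv (shift_coord t k).
have M0 : 0 <= M by apply: sumr_ge0 => *; exact: absv_ge0.
have tM k : absv (shift_coord t k) <= M.
  have [Kk | kK] := leqP K k; first by rewrite tK // absv0.
  rewrite /M (big_cat_nat (n := k)) ?(ltnW kK) //= [X in _ + X]big_ltn //.
  by rewrite addrCA lerDl addr_ge0 // sumr_ge0 // => *; exact: absv_ge0.
pose C := M / (1 - q).
have C0 : 0 <= C by rewrite divr_ge0 // ltW.
(* [N >= K] lets [t] fit into one period; the second summand makes [2 C / (N + 1)] at most
   [e / 2]. *)
pose N := (K + (Num.trunc (2 * C / (e / 2))).+1)%N.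
have N0 : (0 < N)%N by rewrite /N addnS.
pose f k := w ^- (N * (k %/ N)) * shift_coord t (k %% N).
have fS k : w ^+ N * f (k + N)%N = f k.
  rewrite /f divnDr // divnn N0 addn1 modnDr mulnS exprD invfM -!mulrA.
  by rewrite mulVKf // expf_neq0.
have dk k : absv (f k - shift_coord t k) <= if (N <= k)%N then q ^+ (k - N) * M else 0.
  have [kN | Nk] := ltnP k N.
    by rewrite /f divn_small // muln0 expr0 invr1 mul1r modn_small // subrr absv0.
  rewrite (tK k) ?subr0; last by rewrite (leq_trans _ Nk) // /N leq_addr.
  rewrite absvM absvV absvX -exprVn -/q; apply: ler_pM => //.
  - by rewrite exprn_ge0 //; case/andP: q01.
  - exact: absv_ge0.
  (* As [k %% N < N], the exponent [N (k %/ N)] is at least [k - N]. *)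
  - case/andP: q01 => q0 /ltW ?; apply: ler_wiXn2l => //.
    by have := divn_eq k N; have := ltn_pmod k N0; rewrite mulnC; lia.
have sum_d n : \sum_(0 <= k < n) absv (f k - shift_coord t k) / k.+1%:R <= C / N.+1%:R.
  pose b k := if (N <= k)%N then q ^+ (k - N) * M / k.+1%:R else 0.
  have b0 k : 0 <= b k.
    rewrite /b; case: ifP => // _.
    by rewrite divr_ge0 ?mulr_ge0 ?exprn_ge0 //; case/andP: q01.
  apply: (@le_trans _ _ (\sum_(0 <= k < N + n) b k)).
    rewrite [leRHS](big_cat_nat (n := n)) ?leq_addl //= -[leLHS]addr0.
    apply: lerD; last by rewrite sumr_ge0.
    apply: ler_sum => k _; rewrite ler_pdivrMr ?ltr0n //; apply: le_trans (dk k) _.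
    by rewrite /b; case: ifP => _; rewrite ?mul0r // divfK ?pnatr_eq0.
  rewrite (big_cat_nat (n := N)) ?leq_addr //=.
  rewrite [X in X + _](_ : _ = 0) ?add0r; last first.
    by rewrite big_nat_cond big1 // => k /andP[/andP[_ kN] _]; rewrite /b leqNgt kN.
  rewrite -{1}[N]add0n (big_addn 0 (N + n) N) addKn.
  apply: (@le_trans _ _ (\sum_(0 <= k < n) q ^+ k * (M / N.+1%:R))).
    apply: ler_sum => k _; rewrite /b leq_addl addnK -mulrA ler_wpM2l //.
      by rewrite exprn_ge0 //; case/andP: q01.
    by rewrite ler_wpM2l // lef_pV2 ?posrE ?ltr0n // ler_nat ltnS leq_addl.
  rewrite -mulr_suml /C [leRHS]mulrAC mulrC ler_wpM2l ?divr_ge0 //.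
  exact: sum_expr_le.
have [r rd rC] := l1_of_shift_coord sum_d.
have tr k : shift_coord (t + r) k = f k by rewrite shift_coordD rd addrC subrK.
exists (t + r).
  exists N => //; apply: shift_coord_inj => k.
  by rewrite shift_coord_iter !tr fS.
have rC' : abs_sum r <= e / 2.
  apply: le_trans rC _; rewrite mulrA ler_pdivrMr ?ltr0n //.
  have := truncnS_gt (2 * C / (e / 2)); rewrite ltr_pdivrMr // => /ltW/le_trans.
  by apply; rewrite mulrC ler_wpM2l ?(ltW e2) // ler_nat leqW // leq_addl.
have := ltr_leD zt rC'; rewrite -splitr; apply: le_lt_trans.
rewrite -(abs_sumN r) opprD addrA; exact: abs_sumD.
Qed.

Lemma hatA_iter_chaotic (w : F) p : 1 < absv w -> (0 < p)%N ->
  chaotic (iter p (hatA w)).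
Proof.
move=> w1 p0; split; first by apply: hatA_hypercyclic => //; exact: ltW.
apply/l1_denseP => z e e0.
have /l1_denseP/(_ z e e0)[t /= [N N0 tN] zt] := hatA_periodic_dense w1.
exists t => //; exists N => //.
by rewrite -iterM mulnC iterM iter_fix.
Qed.

Lemma shifted_hatA_coord (w l : F) z k :
  shift_coord (shifted (hatA w) l z) k = w * shift_coord z k.+1 - l * shift_coord z k.
Proof. by rewrite shift_coordB shift_coord_hatA shift_coordZ. Qed.

Lemma shifted_hatA_not_injective (w l : F) z : z != 0 ->
  (forall k, w * shift_coord z k.+1 = l * shift_coord z k) ->
  ~ injective (shifted (hatA w) l).
Proof.
move=> z0 E inj; case/eqP: z0; apply: inj.
apply: shift_coord_inj => k.
by rewrite !shifted_hatA_coord E !shift_coord0 !mulr0 !subrr.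
Qed.

Lemma shift_coord_neq0 z : shift_coord z 0 = 1 -> z != 0.
Proof.
move=> z1; apply/eqP => z0; move: z1; rewrite z0 shift_coord0 => /esym/eqP.
by rewrite oner_eq0.
Qed.

(** The eigenvector has the coordinates [(l / w)^k], whose moduli form a convergent geometric
    series. *)
Lemma shifted_hatA_not_injective_lt (w l : F) : absv l < absv w ->
  ~ injective (shifted (hatA w) l).
Proof.
move=> lw; have aw0 : 0 < absv w by apply: le_lt_trans lw; exact: absv_ge0.
have w0 : w != 0 by rewrite -absv_gt0.
have q01 : 0 <= absv (l / w) < 1.
  by rewrite absv_ge0 absvM absvV ltr_pdivrMr // mul1r.
have [|z zl _] := @l1_of_shift_coord R s (fun k => (l / w) ^+ k) (1 - absv (l / w))^-1.
  move=> n; apply: le_trans (sum_expr_le n q01); apply: ler_sum => k _.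
  by rewrite absvX ler_piMr ?exprn_ge0 ?absv_ge0 // invf_le1 ?ler1n ?ltr0n.
apply: (@shifted_hatA_not_injective _ _ z) => [|k].
  by apply: shift_coord_neq0; rewrite zl.
by rewrite !zl exprS mulrA [w * _]mulrC divfK.
Qed.

(** The eigenvector has all coordinates 1. It is built from its tails [1 / (k + 1)], of total
    variation 1, because [l1_of_shift_coord] would require a convergent harmonic series. *)
Lemma shifted_hatA_not_injective_eq (w : F) : ~ injective (shifted (hatA w) w).
Proof.
pose u k : F := of_real s k.+1%:R^-1.
have uE k : u k = k.+1%:R^-1 by exact: of_real_natV.
have u0 : u n @[n --> \oo] --> (0 : F).
  apply/absv_cvgP => e e0; near=> n.
  rewrite sub0r absvN absv_of_real ger0_norm ?invr_ge0 //.
  near: n; have /cvgrPdist_lt/(_ e e0) := @cvg_harmonic R.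
  by apply: filterS => n; rewrite sub0r normrN ger0_norm // invr_ge0.
have [n|z zu _] := @l1_of_tail R s u 1 u0.
  pose b k : R := - k.+1%:R^-1.
  rewrite (eq_bigr (fun k => b k.+1 - b k)) => [|k _].
    by rewrite telescope_sumr // /b opprK invr1 addrC gerBl invr_ge0.
  have -> : u k.+1 - u k = of_real s (k.+2%:R^-1 - k.+1%:R^-1).
    apply: (@addIr _ (u k)); rewrite subrK /u -of_realD subrK.
    by [].
  rewrite absv_of_real ler0_norm ?opprB /b ?opprK; first exact: addrC.
  by rewrite subr_le0 lef_pV2 ?posrE ?ltr0n // ler_nat.
have z1 k : shift_coord z k = 1 by rewrite /shift_coord zu uE divff ?natrS_neq0.
apply: (@shifted_hatA_not_injective _ _ z) => [|k]; last by rewrite !z1.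
exact: shift_coord_neq0.
Unshelve. all: by end_near. Qed.

Lemma shifted_hatA_injective (w l : F) : absv w <= absv l -> l != w ->
  injective (shifted (hatA w) l).
Proof.
move=> wl lw x y xy; apply/eqP; rewrite -subr_eq0; apply/eqP.
apply: (@hatA_eigenvector_eq0 R s w l) => //.
apply: shift_coord_inj => k; rewrite shift_coord_hatA shift_coordZ !shift_coordB.
have := congr1 (fun t => shift_coord t k) xy; rewrite /= !shifted_hatA_coord => /eqP.
rewrite subr_eq => /eqP E; rewrite !mulrBr E.
by rewrite addrC !addrA addNr add0r addrC.
Qed.

(** Solutions are chosen pointwise; injectivity makes the choice linear and a two-sided inverse. *)
Lemma hatA_resolvent (w l : F) : absv w < absv l -> resolvent_set (@hatA R s w) l.
Proof.
move=> wl; have [C solve] := hatA_shifted_solvable wl.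
have lw : l != w by apply: contraTneq wl => ->; rewrite ltxx.
have inj := shifted_hatA_injective (ltW wl) lw.
have solve' g : exists f, shifted (hatA w) l f = g /\ abs_sum f <= C * abs_sum g.
  by have [f fg fC] := solve g; exists f.
have [B Bs] := choice solve'.
have AB : cancel B (shifted (hatA w) l) by move=> g; case: (Bs g).
have BA : cancel (shifted (hatA w) l) B by move=> f; apply: inj; exact: AB.
exists B => //; split.
  by move=> a x y; apply: inj; rewrite AB shifted_hatA_linear !AB.
exists (of_real s C) => x.
by rewrite !normr_l1 -of_realM ler_of_real; case: (Bs x).
Qed.

Lemma shifted_hatA_dense_range (w l : F) : l != 0 ->
  dense (range (@shifted _ l1 (hatA w) l)).
Proof.
move=> l0; apply/l1_denseP => z e e0.
have [K [t tK zt]] := l1_finite_dense z e0; exists t => //.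
(* [g i] is the coordinate of index [K - i]: the equation is solved downwards from zero at [K],
   dividing by [l]. *)
pose g := fix g i := if i is i'.+1
  then l^-1 * (w * g i' - shift_coord t (K - i)%N) else 0.
have [|f fg _] := @l1_finite_shift_coord R s (fun k => g (K - k)%N) K.
  by move=> k; rewrite -subn_eq0 => /eqP ->.
exists f => //; apply: shift_coord_inj => k; rewrite shifted_hatA_coord !fg.
have [Kk | kK] := leqP K k.
  have K0 i : (K <= i)%N -> (K - i = 0)%N by rewrite -subn_eq0 => /eqP.
  by rewrite (K0 k Kk) (K0 k.+1 (leqW Kk)) !mulr0 subrr tK.
rewrite -(subnSK kK) /= mulVKf // opprB addrC subrK.
by congr shift_coord; lia.
Qed.

Lemma harmonic_unbounded (A : R) : exists m, forall k, (m <= k)%N ->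
  A <= \sum_(0 <= j < k) j.+1%:R^-1.
Proof.
have h0 (j : nat) : 0 <= j.+1%:R^-1 :> R by rewrite invr_ge0.
have [m Am] : exists m, A <= \sum_(0 <= j < m) j.+1%:R^-1.
  apply/not_existsP => h; apply: (@dvg_harmonic R).
  apply: nondecreasing_is_cvgn.
    apply/nondecreasing_seqP => n.
    by rewrite !seriesEnat/= big_nat_recr//= lerDl.
  exists A => _ [n _ <-]; rewrite seriesEnat /=.
  by have /negP := h n; rewrite -ltNge => /ltW.
exists m => k mk; apply: le_trans Am _.
by rewrite [leRHS](big_cat_nat (n := m)) //= lerDl sumr_ge0.
Qed.

(* Resonance: with [mu = l / w] and [g_k = l mu^k / (k + 1)], a preimage would
   have the coordinates [mu^k (h_0 + 1 + 1/2 + ... + 1/k)]. *)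
Lemma shifted_hatA_not_surjective (w l : F) : absv l = absv w -> l != w ->
  range (@shifted _ l1 (hatA w) l) <> setT.
Proof.
move=> lw l_neq; have w0 : w != 0.
  apply: contra_neq l_neq => w0; move: lw; rewrite w0 absv0; exact: absv0_eq0.
have aw0 : 0 < absv w by rewrite absv_gt0.
have l0 : l != 0 by rewrite -absv_gt0 lw.
pose mu := l / w.
have mu1 : absv mu = 1 by rewrite absvM absvV lw divff // gt_eqF.
have wmu : w * mu = l by rewrite mulrC divfK.
have d0 : 0 < absv (mu - 1).
  rewrite absv_gt0 subr_eq0; apply: contra_neq l_neq => m1.
  by rewrite -wmu m1 mulr1.
have muX k : absv (mu ^+ k) = 1 by rewrite absvX mu1 expr1n.
have [n|g gE _] := @l1_of_shift_coord R s (fun k => l * mu ^+ k / k.+1%:R) (absv l * 2).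
  rewrite (eq_bigr (fun k => absv l * (k.+1%:R^-1 * k.+1%:R^-1))); last first.
    by move=> k _; rewrite !absvM muX mulr1 absvV absv_nat mulrA.
  rewrite -mulr_sumr ler_wpM2l ?absv_ge0 //.
  (* The bound [2 - 1 / n] makes the induction close. At [n = 0] the convention [0^-1 = 0] turns it
     into 2, so the induction proper starts at 1. *)
  suff : \sum_(0 <= k < n) (k.+1%:R^-1 * k.+1%:R^-1 : R) <= 2 - n%:R^-1.
    by move=> /le_trans; apply; rewrite gerBl invr_ge0.
  elim: n => [|[|n] IH]; first by rewrite big_geq // invr0; lra.
    by rewrite big_nat1 invr1; lra.
  rewrite big_nat_recr //=; apply: (le_trans (lerD IH (lexx _))).
  have : n.+2%:R^-1 <= n.+1%:R^-1 :> R by rewrite lef_pV2 ?posrE ?ltr0n // ler_nat.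
  have E : n.+1%:R^-1 - n.+2%:R^-1 = n.+1%:R^-1 * n.+2%:R^-1 :> R.
    have aux (x : R) : x != 0 -> x + 1 != 0 ->
        x^-1 - (x + 1)^-1 = x^-1 * (x + 1)^-1.
      by move=> x0 x1; field; rewrite x0 x1.
    by rewrite -(natr1 n.+1); apply: aux; rewrite ?natr1 pnatr_eq0.
  move=> /(ler_wpM2r (_ : 0 <= n.+2%:R^-1)); rewrite invr_ge0 ler0n => /(_ isT).
  by rewrite -E; set a := n.+1%:R^-1; set b := n.+2%:R^-1; lra.
move=> rT; have : range (shifted (hatA w) l) g by rewrite rT.
case=> f _ fg.
pose h k : R := \sum_(0 <= j < k) j.+1%:R^-1.
have fS k : w * shift_coord f k.+1 = l * shift_coord f k + l * mu ^+ k / k.+1%:R.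
  by have := shifted_hatA_coord w l f k; rewrite fg gE => ->; rewrite addrC subrK.
have fE k : shift_coord f k = mu ^+ k * (shift_coord f 0 + of_real s (h k)).
  elim: k => [|k IH].
    (* With [0^-1 = 0] the rule for inverses at 0 reads [of_real s 0 = 0]. *)
    have := of_real_natV R s 0; rewrite !invr0 => real0.
    by rewrite /h big_geq // real0 addr0 mul1r.
  apply: (mulfI w0); rewrite fS IH (exprS mu) 2!(mulrA w) wmu.
  rewrite /h big_nat_recr //= of_realD of_real_natV.
  by rewrite (mulrA l) -mulrDr addrA.
(* Beyond [m1] the factor [G] below has modulus at least 1; beyond [m2],
   [1 / (k + 1) <= |mu - 1| / 4]. The main term [(mu - 1) G] then wins by [|mu - 1| / 2]. *)
have [m1 hm1] := harmonic_unbounded (1 + absv (shift_coord f 0)).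
pose m2 := Num.trunc (4 / absv (mu - 1)).
apply: (@l1_not_harmonic R s f (absv (mu - 1) / 2) 1 (m1 + m2)) => // [|k].
  by rewrite divr_gt0.
rewrite muln1 => mk; rewrite -[X in _ <= X * _](absv_nat R s) -absvM.
rewrite l1_seq_mul_shift_coord (fE k.+1) (fE k).
rewrite /h big_nat_recr //= -/(h k) of_realD of_real_natV.
set G := shift_coord f 0 + of_real s (h k).
have G1 : 1 <= absv G.
  have := lerB_absv (of_real s (h k)) (- shift_coord f 0).
  rewrite opprK absvN (addrC (of_real _ _)) -/G absv_of_real.
  have := hm1 k (leq_trans (leq_addr _ _) mk); have := ler_norm (h k); rewrite /h; lra.
have r4 : k.+1%:R^-1 <= absv (mu - 1) / 4.
  rewrite -[leRHS]invrK lef_pV2 ?posrE ?ltr0n ?invr_gt0 ?divr_gt0 // invf_div.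
  apply: le_trans (ltW (truncnS_gt _)) _; rewrite ler_nat ltnS.
  exact: leq_trans (leq_addl m1 m2) mk.
have -> : mu ^+ k.+1 * (shift_coord f 0 + (of_real s (h k) + k.+1%:R^-1)) -
    mu ^+ k * G - mu ^+ k * G / k.+1%:R =
    mu ^+ k * ((mu - 1) * G - (G / k.+1%:R - mu / k.+1%:R)).
  by rewrite exprS; exact: resonance_identity.
rewrite absvM muX mul1r.
apply: le_trans (lerB_absv _ _); rewrite absvM.
have := absvD (G / k.+1%:R) (- (mu / k.+1%:R)).
rewrite absvN (absvM G) (absvM mu) mu1 absvV absv_nat mul1r => hG.
have : 0 <= absv G * (absv (mu - 1) / 4 - k.+1%:R^-1).
  by rewrite mulr_ge0 ?absv_ge0 // subr_ge0.
have : 0 <= (absv G - 1) * absv (mu - 1) by rewrite mulr_ge0 ?absv_ge0 // subr_ge0.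
move: hG r4; set r : R := k.+1%:R^-1; set x := absv (G / _ - _); lra.
Qed.

End chaos_and_spectrum.

(** This is [hatA_iter_coord] at the 0-based index [k - 1]; the sum is then the tail of index
    [k - 1 + n]. *)
Lemma hatA_iter_l1_coord (R : realType) (s : scalar_kind) (w : scalars R s)
    (n : nat) (z : l1 R s) (k : nat) : (0 < k)%N -> (0 < n)%N ->
  l1_coord (iter n (hatA w) z) k =
  w ^+ n * ((k + 1 + n)%:R / (k + 1)%:R * l1_coord z (k + n)
            - n%:R / (k * (k + 1))%:R * \sum_(0 <= j < k + n) l1_coord z j).
Proof.
case: k => // k _ n0; rewrite [LHS]hatA_iter_coord !addn1.
by rewrite addSn -[\sum_(_ <= j < _) _]/(l1_tail z (k + n)).
Qed.

(** * The spectrum and its parts over the complex field *)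

Section complex_spectrum.
Variable R : realType.
Variable w : R[i].
Local Notation A := (hatA (w : scalars R complex_scalars)).
Local Notation abs := (@absv R complex_scalars).

Lemma complex_normr (x : R[i]) : `|x| = (abs x)%:C%C.
Proof. exact: (normr_absv (x : scalars R complex_scalars)). Qed.

Lemma hatA_spectrum : spectrum A = [set lambda : R[i] | `|lambda| <= `|w|].
Proof.
apply/seteqP; split => l /=; rewrite !complex_normr lecR.
  by move=> lr; rewrite leNgt; apply/negP => wl; apply: lr; exact: hatA_resolvent.
move=> lw [B _ [BA AB]].
have inj : injective (shifted A l) by exact: can_inj BA.
move: lw; rewrite le_eqVlt => /orP[/eqP lw|/shifted_hatA_not_injective_lt]; last exact.
have [lw' | lw'] := eqVneq (l : scalars R complex_scalars) w.
  by move: inj; rewrite lw'; exact: shifted_hatA_not_injective_eq.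
apply: (shifted_hatA_not_surjective lw lw').
by apply/seteqP; split=> // g _; exists (B g) => //; exact: AB.
Qed.

Lemma hatA_point_spectrum :
  point_spectrum A = [set lambda : R[i] | `|lambda| < `|w|] `|` [set w].
Proof.
apply/seteqP; split => l /=; rewrite !complex_normr ltcR.
  move=> ninj; have [->|lw] := eqVneq l w; [by right | left].
  by rewrite ltNge; apply/negP => wl; apply: ninj; exact: shifted_hatA_injective.
case=> [|->]; first exact: shifted_hatA_not_injective_lt.
exact: shifted_hatA_not_injective_eq.
Qed.

Lemma hatA_continuous_spectrum :
  continuous_spectrum A = [set lambda : R[i] | `|lambda| = `|w|] `\ w.
Proof.
apply/seteqP; split => l /=.
  case=> inj nsurj _; rewrite /setD /= !complex_normr.
  have lw : l <> w.
    by move=> lw; move: inj; rewrite lw; exact: shifted_hatA_not_injective_eq.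
  split=> //; congr (_%:C%C); apply/eqP; rewrite eq_le; apply/andP; split.
    rewrite leNgt; apply/negP => /hatA_resolvent[B _ [_ AB]]; apply: nsurj.
    by apply/seteqP; split=> // g _; exists (B g) => //; exact: AB.
  by rewrite leNgt; apply/negP => /shifted_hatA_not_injective_lt.
rewrite /setD /= !complex_normr => -[/complexI lw /eqP l_neq]; split.
- by apply: shifted_hatA_injective => //; rewrite lw.
- exact: shifted_hatA_not_surjective.
(* On the circle [l = 0] would force [w = 0 = l]. *)
- apply: shifted_hatA_dense_range; apply: contra_neq l_neq => l0.
  by move: lw; rewrite l0 absv0 => /esym/absv0_eq0 ->.
Qed.

End complex_spectrum.

Theorem theorem6p3 (R : realType) :
  (forall (s : scalar_kind) (w : scalars R s),
    [/\ bounded_operator (hatA w),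
        `|w| < 1 -> ~ hypercyclic (hatA w),
        `|w| = 1 -> hypercyclic (hatA w) /\ ~ chaotic (hatA w)
      & 1 < `|w| ->
          chaotic (hatA w) /\
          forall n : nat, (0 < n)%N ->
            (forall (z : l1 R s) (k : nat), (0 < k)%N ->
               l1_coord (iter n (hatA w) z) k =
               w ^+ n * ((k + 1 + n)%:R / (k + 1)%:R * l1_coord z (k + n)
                         - n%:R / (k * (k + 1))%:R
                           * \sum_(0 <= j < k + n) l1_coord z j)) /\
            chaotic (iter n (hatA w))]) /\
  (forall w : R[i],
    let A := hatA (w : scalars R complex_scalars) in
    [/\ spectrum A = [set lambda : R[i] | `|lambda| <= `|w|],
        point_spectrum A = [set lambda : R[i] | `|lambda| < `|w|] `|` [set w]
      & continuous_spectrum A =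
          [set lambda : R[i] | `|lambda| = `|w|] `\ w]).
Proof.
split=> [s w|w]; last first.
  by split; [exact: hatA_spectrum | exact: hatA_point_spectrum
            | exact: hatA_continuous_spectrum].
have -> : (`|w| < 1) = (absv w < 1) by rewrite normr_absv -(of_real1 R s) ltr_of_real.
have -> : (1 < `|w|) = (1 < absv w) by rewrite normr_absv -(of_real1 R s) ltr_of_real.
split=> [|w1|w1|w1].
- exact: hatA_bounded.
- exact: hatA_not_hypercyclic.
- have {}w1 : absv w = 1 by apply: (@of_real_inj R s); rewrite of_real1 -normr_absv.
  split; last exact: hatA_not_chaotic.
  (* The operator itself is the power with exponent [p = 1]. *)
  by apply: (@hatA_hypercyclic _ _ w 1) => //; rewrite w1.
- split; first exact: (@hatA_iter_chaotic _ _ w 1).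
  move=> n n0; split=> [z k k0|]; last exact: hatA_iter_chaotic.
  exact: hatA_iter_l1_coord.
Qed.
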